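(* Let $u_h$ be the fine-grid semi-discrete solution, $u_H$ the semi-discrete multiscale interior penalty discontinuous Galerkin (IPDG) solution and $w_H$ the elliptic projection of $u_h$ (all defined in the context), and set $\eta=u_h-w_H$, $\xi=u_H-w_H$, $\varepsilon=u_h-u_H$. Then there is a constant $C>0$, independent of $h$, $H$ and of the functions $u_h,u_H,w_H$, such that $$\|\varepsilon\|_{L^\infty([0,T];L^2(\Omega))}\le C\Big(\|\eta_t\|_{L^1([0,T];L^2(\Omega))}+\|\eta\|_{L^\infty([0,T];L^2(\Omega))}+\mathcal I_2\Big),$$ where $\mathcal I_2=\|\xi(0)\|_{L^2(\Omega)}$.
   Context: Meshes and coefficient. $\Omega\subset\mathbb R^2$ is a bounded domain partitioned by a fine mesh $\mathcal T^h$ of rectangles with maximum side length $h$. $\mathcal T^H$ is a coarse mesh of size $H$ whose blocks $K$ are connected unions of fine rectangles; $\mathcal E^H$ is the set of coarse edges. The coefficient $a(x)$ satisfies $a_0\le a(x)\le a_1$ for all $x\in\Omega$, with constants $a_0,a_1>0$. $(\cdot,\cdot)$ is the $L^2(\Omega)$ inner product. Fine-grid solution. $V_h$ is the space of continuous piecewise bilinear functions on $\mathcal T^h$ vanishing on $\partial\Omega$. $f(x,t)$ is a given source, $g_0,g_1$ are the given initial position and velocity, $T>0$. $u_h(t,\cdot)\in V_h$ satisfies $(\partial_t^2u_h,v)+\int_\Omega a\nabla u_h\cdot\nabla v=(f,v)$ for all $v\in V_h$. Multiscale space. For a coarse block $K$, $V_h(K)$ is the space of continuous piecewise bilinear functions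 on the fine rectangles of $K$, and $V_h^0(K)$ is the subspace of functions vanishing on $\partial K$. $V_H^1(K)$ is the $n$-dimensional space ($n$ = number of fine nodes on $\partial K$, depending on $K$) of $w\in V_h(K)$ with $\int_Ka\nabla w\cdot\nabla v=0$ for all $v\in V_h^0(K)$. Let $0=\mu_{1,K}<\mu_{2,K}\le\dots\le\mu_{n,K}$ and $\widetilde w_{i,K}\in V_H^1(K)$ be the eigenpairs of $\int_Ka\nabla w\cdot\nabla v=\frac{\mu}{H}\int_{\partial K}wv$ for all $v\in V_H^1(K)$, the $\widetilde w_{i,K}$ orthonormal in $L^2(\partial K)$. Let $\lambda_{1,K}\le\lambda_{2,K}\le\dots$ and $z_{i,K}\in V_h^0(K)$ be the eigenpairs of $\int_Ka\nabla z\cdot\nabla v=\frac{\lambda}{H^2}\int_Kzv$ for all $v\in V_h^0(K)$, the $z_{i,K}$ orthonormal in $L^2(K)$. For chosen integers $p,m$ (possibly depending on $K$), $V_H$ is the space of functions on $\Omega$, in general discontinuous across coarse edges, whose restriction to each $K$ lies in $\mathrm{span}\{\widetilde w_{1,K},\dots,\widetilde w_{p,K},z_{1,K},\dots,z_{m,K}\}$. IPDG form. For an interior coarse edge $e$ shared by $K^+$ and $K^-$, with unit normal $n$ pointing from $K^+$ to $K^-$, $\{v\}_e=\frac12(v^++v^-)$ and $[v]_e=v^+-v^-$; for $e\subset\partial\Omega$, with $n$ the outward normal, $\{v\}_e=[v]_e=v$. With penalty parameter $\gamma>0$, $$a_{DG}(u,v)=\sum_{K\in\mathcal T^H}\int_Ka\nabla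 u\cdot\nabla v+\sum_{e\in\mathcal E^H}\Big(-\int_e\{a\nabla u\cdot n\}_e[v]_e-\int_e\{a\nabla v\cdot n\}_e[u]_e+\frac{\gamma}{h}\int_ea[u]_e[v]_e\Big).$$ $u_H(t,\cdot)\in V_H$ satisfies $(\partial_t^2u_H,v)+a_{DG}(u_H,v)=(f,v)$ for all $v\in V_H$, with $u_H(0)=P_H g_0$, $(u_H)_t(0)=P_Hg_1$, $P_H$ being the $L^2$-projection onto $V_H$. The initial data of $u_h$ represent the same $g_0,g_1$: $P_Hu_h(0)=P_Hg_0$ and $P_H(u_h)_t(0)=P_Hg_1$. Norms. $\|u\|_a^2=\sum_K\int_Ka|\nabla u|^2+\frac{\gamma}{h}\sum_{e\in\mathcal E^H}\|a^{1/2}[u]_e\|_{L^2(e)}^2$ for $u$ piecewise $H^1$ on $\mathcal T^H$. For a space-time function, $\|\cdot\|_{L^\infty([0,T];X)}=\max_{0\le t\le T}\|\cdot\|_X$ and $\|\cdot\|_{L^1([0,T];X)}=\int_0^T\|\cdot\|_X\,dt$. Penalty parameter. $\gamma$ is taken sufficiently large that $\frac12\|v\|_a^2\le a_{DG}(v,v)$ and $a_{DG}(u,v)\le2\|u\|_a\|v\|_a$ for all $u,v\in V_H$. Elliptic projection. The consistency error is $R_{u_h}(v)=(f,v)-(\partial_t^2u_h,v)-a_{DG}(u_h,v)$ for $v\in V_H$. For each $t$, $w_H\in V_H$ is defined by $a_{DG}(w_H,v)=a_{DG}(u_h,v)+R_{u_h}(v)$ for all $v\in V_H$. The data are assumed smooth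 enough in time that $u_h,w_H,u_H$ are twice differentiable in time. *)

(* Defs.v *)
From HB Require Import structures.
From mathcomp Require Import all_boot all_order all_algebra.
From mathcomp Require Import all_classical all_reals all_analysis.

Set Implicit Arguments.
Unset Strict Implicit.
Unset Printing Implicit Defensive.

Import Order.TTheory GRing.Theory Num.Theory.
Import numFieldNormedType.Exports.

Local Open Scope classical_set_scope.
Local Open Scope ring_scope.

Section Plane.
Context {R : realType}.
Implicit Types (A Om : set (R * R)) (x y : R * R).

Definition bdry A : set (R * R) := closure A `\` interior A.

Definition bounded_domain Om : Prop :=
  [/\ open Om, connected Om, Om !=set0 & bounded_set Om].

Definition eucl_dist x y : R :=
  Num.sqrt ((x.1 - y.1) ^+ 2 + (x.2 - y.2) ^+ 2).

Definition diameter A : R :=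
  sup [set r | exists x y, [/\ A x, A y & r = eucl_dist x y]].

Definition int2 A (g : R * R -> R) : R :=
  \int[(lebesgue_measure \x lebesgue_measure)%E]_(x in A) g x.

(* The edge terms of the discontinuous Galerkin form use the values of the
   coefficient on the closed cells, whence the closure. *)
Definition coefficient Om (a : R * R -> R) (a0 a1 : R) : Prop :=
  [/\ 0 < a0, 0 < a1, measurable_fun (closure Om) a
    & forall x, closure Om x -> a0 <= a x <= a1].

Definition L2fun Om (g : R * R -> R) : Prop :=
  measurable_fun Om g /\
  (lebesgue_measure \x lebesgue_measure)%E.-integrable Om
    (fun x => (g x ^+ 2)%:E).

Definition L2ip Om (g1 g2 : R * R -> R) : R := int2 Om (fun x => g1 x * g2 x).

Definition bilinear_poly (g : R * R -> R) : Prop :=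
  exists c0 c1 c2 c3 : R,
    forall x, g x = c0 + c1 * x.1 + c2 * x.2 + c3 * (x.1 * x.2).

Definition gradx (g : R * R -> R) x : R := 'D_(1, 0) g x.
Definition grady (g : R * R -> R) x : R := 'D_(0, 1) g x.

Definition grad_dot (g1 g2 : R * R -> R) x : R :=
  gradx g1 x * gradx g2 x + grady g1 x * grady g2 x.

End Plane.

(* A side of an axis-parallel rectangle is coded by (d, o) : bool * bool.
   For d = false the normal is parallel to the first axis, for d = true to the
   second one; o tells whether the outward normal points in the positive
   direction of that axis. *)
Definition side_type : Type := (bool * bool)%type.

Definition opposite (s : side_type) : side_type := (s.1, ~~ s.2).

Section Rectangles.
Context {R : realType} {N : nat}.
Variables (lo hi : 'I_N -> R * R).
Implicit Types (i j : 'I_N) (s : side_type).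

Definition rect i : set (R * R) :=
  [set x | (lo i).1 <= x.1 <= (hi i).1 /\ (lo i).2 <= x.2 <= (hi i).2].

Definition orect i : set (R * R) :=
  [set x | (lo i).1 < x.1 < (hi i).1 /\ (lo i).2 < x.2 < (hi i).2].

Definition corner i (o : bool * bool) : R * R :=
  (if o.1 then (hi i).1 else (lo i).1, if o.2 then (hi i).2 else (lo i).2).

Definition side_range i s : set R :=
  [set` if s.1 then `[(lo i).1, (hi i).1] else `[(lo i).2, (hi i).2]].

Definition side_point i s (r : R) : R * R :=
  if s.1 then (r, if s.2 then (hi i).2 else (lo i).2)
  else (if s.2 then (hi i).1 else (lo i).1, r).

Definition side i s : set (R * R) := side_point i s @` side_range i s.

Definition side_int i s (g : R * R -> R) : R :=
  \int[lebesgue_measure]_(r in side_range i s) g (side_point i s r).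

(* No hanging nodes. *)
Definition conforming : Prop :=
  forall i j, i != j ->
  [\/ rect i `&` rect j = set0,
      exists o o', corner i o = corner j o' /\
        rect i `&` rect j = [set corner i o]
    | exists s s', side i s = side j s' /\ rect i `&` rect j = side i s].

End Rectangles.

(* Fine rectangles are indexed by 'I_ncell and coarse blocks by 'I_nblock;
   blk maps a fine rectangle to the block that contains it. *)
Record mesh {R : realType} (Om : set (R * R)) := Mesh {
  ncell : nat;
  nblock : nat;
  lo : 'I_ncell -> R * R;
  hi : 'I_ncell -> R * R;
  blk : 'I_ncell -> 'I_nblock;
  mesh_nondeg : forall i, (lo i).1 < (hi i).1 /\ (lo i).2 < (hi i).2;
  mesh_conforming : conforming lo hi;
  (* Omega is the whole interior of the closed union: slits are excluded. *)
  mesh_cover : Om = interior (\bigcup_(i in [set: 'I_ncell]) rect lo hi i);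
  blk_surj : forall K, exists i, blk i = K;
  blk_connected :
    forall K, connected (\bigcup_(i in [set i | blk i = K]) rect lo hi i)
}.

Section Broken.
Context {R : realType} {Om : set (R * R)}.
Variable M : mesh Om.

Local Notation cell := 'I_(ncell M).
Local Notation block := 'I_(nblock M).
Local Notation rect := (rect (@lo R Om M) (@hi R Om M)).
Local Notation orect := (orect (@lo R Om M) (@hi R Om M)).
Local Notation side := (side (@lo R Om M) (@hi R Om M)).
Local Notation side_int := (side_int (@lo R Om M) (@hi R Om M)).
Local Notation corner := (corner (@lo R Om M) (@hi R Om M)).

Definition fine_size : R :=
  \big[Num.max/0]_(i < ncell M)
     Num.max ((hi i).1 - (lo i).1) ((hi i).2 - (lo i).2).

Definition block_set (K : block) : set (R * R) :=
  \bigcup_(i in [set i : cell | blk i = K]) rect i.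

(* The choice of size only rescales the eigenvalues below, hence does not
   affect the multiscale space. *)
Definition coarse_size : R :=
  \big[Num.max/0]_(K < nblock M) diameter (block_set K).

(* A function that is smooth on each fine rectangle is given by its pieces:
   u i is the piece on the i-th rectangle.  The pieces are polynomials, hence
   defined on the whole plane, so that u i and its gradient also have values
   (the traces from inside) on the sides of the i-th rectangle. *)
Definition broken : Type := cell -> R * R -> R.
Implicit Types (u v w : broken) (K : block).

Definition bsub u v : broken := fun i x => u i x - v i x.

(* The function on Om defined by the pieces, up to a null set. *)
Definition glued u (x : R * R) : R := \sum_(i : cell) \1_(orect i) x * u i x.

Definition L2norm u : R := Num.sqrt (L2ip Om (glued u) (glued u)).

Definition piecewise_bilinear u : Prop := forall i, bilinear_poly (u i).

Definition Vh : set broken :=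
  [set u | [/\ piecewise_bilinear u,
    forall i j x, rect i x -> rect j x -> u i x = u j x
    & forall i x, rect i x -> bdry Om x -> u i x = 0]].

(* Functions on K are extended by zero. *)
Definition VhK K : set broken :=
  [set u | [/\ piecewise_bilinear u,
    forall i j x, blk i = K -> blk j = K ->
      rect i x -> rect j x -> u i x = u j x
    & forall i x, blk i <> K -> u i x = 0]].

Definition VhK0 K : set broken :=
  [set u | VhK K u /\
    forall i x, blk i = K -> rect i x -> bdry (block_set K) x -> u i x = 0].

Definition intK K (phi : cell -> R * R -> R) : R :=
  \sum_(i | blk i == K) int2 (orect i) (phi i).

Definition int_bdryK K (phi : cell -> R * R -> R) : R :=
  \sum_(i | blk i == K)
    \sum_(s : side_type | `[< side i s `<=` bdry (block_set K) >])
      side_int i s (phi i).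

Definition massK K u v : R := intK K (fun i x => u i x * v i x).
Definition mass_bdryK K u v : R := int_bdryK K (fun i x => u i x * v i x).

Definition nbnodes K : nat :=
  size (undup [seq corner io.1 io.2 | io <- enum {: cell * (bool * bool)} &
    (blk io.1 == K) && `[< bdry (block_set K) (corner io.1 io.2) >]]).

Section Coefficient.
Variable a : R * R -> R.

Definition stiffK K u v : R := intK K (fun i x => a x * grad_dot (u i) (v i) x).

Definition stiff u v : R := \sum_(K < nblock M) stiffK K u v.

Definition VH1K K : set broken :=
  [set w | VhK K w /\ forall v, VhK0 K v -> stiffK K w v = 0].

(* ef, ev : all the eigenpairs, with multiplicity and in increasing order, of
   b1(u, v) = ev / s * b2(u, v) for v in V, with ef a b2-orthonormal basis
   of V. *)
Definition eigensystem (V : set broken) (b1 b2 : broken -> broken -> R) (s : R)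
    (n : nat) (ev : 'I_n -> R) (ef : 'I_n -> broken) : Prop :=
  [/\ forall j, V (ef j),
      forall j v, V v -> b1 (ef j) v = ev j / s * b2 (ef j) v,
      forall j k, b2 (ef j) (ef k) = (j == k)%:R,
      forall j k : 'I_n, (j <= k)%N -> ev j <= ev k
    & forall v, V v ->
        exists c : 'I_n -> R, forall i x, v i x = \sum_j c j * ef j i x].

Record local_bases := LocalBases {
  mu : forall K, 'I_(nbnodes K) -> R;
  wt : forall K, 'I_(nbnodes K) -> broken;
  wt_eigen : forall K,
    eigensystem (VH1K K) (stiffK K) (mass_bdryK K) coarse_size
      (@mu K) (@wt K);
  mu_first : forall K (j : 'I_(nbnodes K)), nat_of_ord j = 0%N -> mu j = 0;
  mu_pos : forall K (j : 'I_(nbnodes K)), (0 < j)%N -> 0 < mu j;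
  nint : block -> nat;
  lam : forall K, 'I_(nint K) -> R;
  z : forall K, 'I_(nint K) -> broken;
  z_eigen : forall K,
    eigensystem (VhK0 K) (stiffK K) (massK K) (coarse_size ^+ 2)
      (@lam K) (@z K)
}.
Arguments wt B {K} _ : rename.
Arguments z B {K} _ : rename.

(* Continuity across coarse edges is not imposed. *)
Definition VH (B : local_bases) (p m : block -> nat) : set broken :=
  [set u | forall K, exists (c : 'I_(nbnodes K) -> R) (d : 'I_(nint B K) -> R),
    forall i x, blk i = K ->
      u i x = \sum_(j < nbnodes K | (j < p K)%N) c j * wt B j i x
            + \sum_(j < nint B K | (j < m K)%N) d j * z B j i x].

(* The integral over a coarse edge is the sum of the integrals over the fine
   sides that compose it, so a sum over all coarse edges is written as a sum
   over fine sides.  Such a side is coded by a triple (i, s, oj):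
   - oj = Some j: side s of i in K+ is also a side of j in K-; each
     pair of blocks is taken once, K+ having the smaller index;
   - oj = None: side s of i lies on the boundary of Om.
   In both cases n is the outward normal of the i-th rectangle on side s. *)
Definition on_skeleton (i : cell) (s : side_type) (oj : option cell) : bool :=
  if oj is Some j then
    (blk i < blk j)%N && `[< side i s = side j (opposite s) >]
  else `[< side i s `<=` bdry Om >].

Definition skeleton_sum
    (phi : cell -> side_type -> option cell -> R * R -> R) : R :=
  \sum_(i : cell) \sum_(s : side_type)
    \sum_(oj : option cell | on_skeleton i s oj) side_int i s (phi i s oj).

Definition normal_flux u (i : cell) (s : side_type) (x : R * R) : R :=
  a x * ((if s.2 then 1 else - 1) *
         (if s.1 then grady (u i) x else gradx (u i) x)).

Definition avg_flux u i s (oj : option cell) x : R :=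
  if oj is Some j then (normal_flux u i s x + normal_flux u j s x) / 2
  else normal_flux u i s x.

Definition jump u i (oj : option cell) x : R :=
  if oj is Some j then u i x - u j x else u i x.

Definition aDG (gamma : R) u v : R :=
  stiff u v
  + (- skeleton_sum (fun i s oj x => avg_flux u i s oj x * jump v i oj x)
     - skeleton_sum (fun i s oj x => avg_flux v i s oj x * jump u i oj x)
     + gamma / fine_size *
       skeleton_sum (fun i s oj x => a x * jump u i oj x * jump v i oj x)).

Definition norm_a (gamma : R) u : R :=
  Num.sqrt (stiff u u + gamma / fine_size *
    skeleton_sum (fun i s oj x => (Num.sqrt (a x) * jump u i oj x) ^+ 2)).

Definition penalty_large (V : set broken) (gamma : R) : Prop :=
  0 < gamma /\
  forall u v, V u -> V v ->
    norm_a gamma v ^+ 2 / 2 <= aDG gamma v v /\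
    aDG gamma u v <= 2 * norm_a gamma u * norm_a gamma v.

(* The source and the second time derivative of u_h are taken at one time. *)
Definition consistency_error (gamma : R) (f : R * R -> R) u utt v : R :=
  L2ip Om f (glued v) - L2ip Om (glued utt) (glued v)
  - aDG gamma u v.

End Coefficient.

Definition L2proj (V : set broken) (g : R * R -> R) (q : broken) : Prop :=
  V q /\ forall v, V v -> L2ip Om (glued q) (glued v) = L2ip Om g (glued v).

Definition same_L2proj (V : set broken) (g1 g2 : R * R -> R) : Prop :=
  exists q, L2proj V g1 q /\ L2proj V g2 q.

Section Time.
Variable T : R.
Implicit Types U V : R -> broken.

(* One-sided at 0 and T; pointwise in space, which is equivalent to
   differentiability in norm on finite-dimensional spaces. *)
Definition time_derivative U V : Prop :=
  forall t : R, 0 <= t <= T -> forall i x,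
    (fun s => (U s i x - U t i x) / (s - t)) @
      within [set s : R | 0 <= s <= T] t^' --> V t i x.

(* For continuous U the supremum is the maximum over [0, T]. *)
Definition Linf_L2 U : R := sup [set L2norm (U t) | t in `[0, T]].

Definition L1_L2 U : R := \int[lebesgue_measure]_(t in `[0, T]) L2norm (U t).

End Time.
End Broken.

Arguments Vh {R Om} M.

(* Main.v *)
(** Baker's duality argument.  With [xi = u_H - w_H], subtracting the equation
    of the elliptic projection from that of [u_H] gives, for [v] in [V_H],
    [(d_t^2 u_H - d_t^2 u_h, v) + a_DG(xi, v) = 0].  Testing with
    [phi(t) = \int_t^tau xi], which lies in [V_H] and satisfies [phi' = - xi]
    and [phi(tau) = 0], shows that
    [(d_t u_H - d_t u_h, phi) + |xi|^2 / 2 - a_DG(phi, phi) / 2] has derivative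
    [(eta_t, xi)].  Its first term vanishes at [0] by the choice of the initial
    velocities, and [a_DG(phi, phi) >= 0] by the choice of the penalty, whence
    [|xi(tau)|^2 <= |xi(0)|^2 + 2 \int_0^tau |eta_t| |xi|].  Choosing for [tau]
    the time at which [|xi|] is maximal, one may divide by [|xi(tau)|].

    All functions involved are bilinear on each fine rectangle, hence are
    determined by their values at the four corners of the unit square; in these
    coordinates the [L^2] product and [a_DG] become bilinear forms given by
    finite matrices. *)

Require Import Defs.
From HB Require Import structures.
From mathcomp Require Import all_boot all_order all_algebra.
From mathcomp Require Import all_classical all_reals all_analysis.
From mathcomp Require Import measurable_realfun ring lra.

Set Implicit Arguments.
Unset Strict Implicit.
Unset Printing Implicit Defensive.

Import Order.TTheory GRing.Theory Num.Theory.
Import numFieldNormedType.Exports.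

Local Open Scope classical_set_scope.
Local Open Scope ring_scope.

(** * Calculus on [0, T] *)

Section Calculus.
Context {R : realType}.
Variable T : R.
Hypothesis T_gt0 : 0 < T.
Implicit Types (f g : R -> R).

(** Continuity is asked up to the endpoints, the derivative only inside. This is stable under sums
    and products, holds for integrals of continuous functions and suffices for monotonicity
    arguments. *)
Definition derivative_on f g : Prop :=
  {within `[0, T], continuous f} /\
  forall t, t \in `]0, T[ -> is_derive t 1 f (g t).

Lemma within_continuous_sum (I : Type) (r : seq I) (F : I -> R -> R) (A : set R) :
  (forall i, {within A, continuous F i}) ->
  {within A, continuous fun t => \sum_(i <- r) F i t}.
Proof.
move=> cF; elim: r => [|i r ih] x.
  by under eq_fun do rewrite big_nil; exact: cvg_cst.
by under eq_fun do rewrite big_cons; apply: cvgD; [exact: cF|exact: ih].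
Qed.

Lemma within_continuousM f g (A : set R) :
  {within A, continuous f} -> {within A, continuous g} ->
  {within A, continuous fun t => f t * g t}.
Proof.
move=> /subspace_continuousP cf /subspace_continuousP cg.
by apply/subspace_continuousP => x Ax; apply: cvgM; [exact: cf|exact: cg].
Qed.

Lemma within_continuous_cst (c : R) (A : set R) :
  {within A, continuous fun=> c}.
Proof. by apply/subspace_continuousP => x Ax; exact: cvg_cst. Qed.

Lemma derivative_onD f g f' g' : derivative_on f f' -> derivative_on g g' ->
  derivative_on (fun t => f t + g t) (fun t => f' t + g' t).
Proof.
move=> [cf df] [cg dg]; split.
  by move=> t; apply: cvgD; [exact: cf|exact: cg].
by move=> t tT; apply: is_deriveD; [exact: df|exact: dg].
Qed.

Lemma derivative_on_cst (c : R) : derivative_on (fun=> c) (fun=> 0).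
Proof. by split; [exact: within_continuous_cst|move=> t _; exact: is_derive_cst]. Qed.

Lemma derivative_onM f g f' g' : derivative_on f f' -> derivative_on g g' ->
  derivative_on (fun t => f t * g t) (fun t => f' t * g t + f t * g' t).
Proof.
move=> [cf df] [cg dg]; split; first exact: within_continuousM.
move=> t tT; apply: is_derive_eq.
  by apply: is_deriveM; [exact: df|exact: dg].
by rewrite /GRing.scale /= addrC (mulrC (f' t)).
Qed.

Lemma derivative_onZ (c : R) f f' : derivative_on f f' ->
  derivative_on (fun t => c * f t) (fun t => c * f' t).
Proof.
move=> df; have [c1 d1] := derivative_onM (derivative_on_cst c) df.
split=> // t tT; apply: is_derive_eq; first exact: d1.
by rewrite mul0r add0r.
Qed.

Lemma derivative_onB f g f' g' : derivative_on f f' -> derivative_on g g' ->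
  derivative_on (fun t => f t - g t) (fun t => f' t - g' t).
Proof.
move=> df /(derivative_onZ (-1)) dg; have := derivative_onD df dg.
under eq_fun do rewrite mulN1r.
by under [X in derivative_on _ X]eq_fun do rewrite mulN1r.
Qed.

Lemma derivative_on_sum (I : Type) (r : seq I) (F F' : I -> R -> R) :
  (forall i, derivative_on (F i) (F' i)) ->
  derivative_on (fun t => \sum_(i <- r) F i t) (fun t => \sum_(i <- r) F' i t).
Proof.
move=> dF; elim: r => [|i r ih].
  under eq_fun do rewrite big_nil.
  under [X in derivative_on _ X]eq_fun do rewrite big_nil.
  exact: derivative_on_cst.
under eq_fun do rewrite big_cons.
under [X in derivative_on _ X]eq_fun do rewrite big_cons.
exact: derivative_onD.
Qed.

Lemma derivative_on_antiderivative f : {within `[0, T], continuous f} ->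
  derivative_on (fun x => \int[lebesgue_measure]_(t in `[0, x]) f t) f.
Proof.
move=> cf.
have intf : lebesgue_measure.-integrable `[0, T] (EFin \o f).
  by apply: continuous_compact_integrable => //; exact: segment_compact.
split.
  exact: (@parameterized_integral_continuous R 0 T f (ltW T_gt0) intf).
move=> t; rewrite in_itv/= => /andP[t0 tT].
have ct : {for t, continuous f}.
  by apply: (within_continuous_continuous T_gt0 cf); rewrite in_itv/= t0 tT.
have [] := continuous_FTC1_closed tT intf t0 ct.
by rewrite derive1E => d1 d2; apply: DeriveDef.
Qed.

(** The energy inequality is read off from the sign of a derivative in this way, without integrating
    that derivative. *)
Lemma derivative_on_le f f' (a b : R) : 0 <= a -> a <= b -> b <= T ->
  derivative_on f f' -> (forall t, a < t < b -> f' t <= 0) -> f b <= f a.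
Proof.
move=> a0 ab bT [cf df] f'0.
have sub x : x \in `]a, b[ -> x \in `]0, T[.
  by rewrite !in_itv/= => /andP[ax xb]; rewrite (le_lt_trans a0)//= (lt_le_trans xb).
apply: (@ler0_derive1_le_cc _ f a b) => //.
- by move=> x /sub xT; exact: (@ex_derive _ _ _ _ _ _ _ (df x xT)).
- move=> x xab; rewrite derive1E (@derive_val _ _ _ _ _ _ _ (df x (sub _ xab))).
  by rewrite f'0//; rewrite in_itv in xab.
- by apply: continuous_subspaceW cf; apply: subset_itv; rewrite bnd_simp.
- by rewrite in_itv/= ab lexx.
- by rewrite in_itv/= lexx ab.
Qed.

(** No point of [[0, T]] is isolated in it because [0 < T]. Properness makes limits along this
    filter unique. *)
Lemma within_dnbhs_itv_proper (t : R) : 0 <= t <= T ->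
  ProperFilter (within [set s : R | 0 <= s <= T] t^').
Proof.
move=> /andP[t0 tT]; apply: Build_ProperFilter_ex => P.
rewrite /within/= /dnbhs/= /within/= -nbhs_nearE => -[e /= e0 he].
pose d := Num.min (e / 2) (T / 2).
have d0 : 0 < d by rewrite /d lt_min !divr_gt0.
have de : d < e by rewrite /d gt_min; apply/orP; left; lra.
have dT : d <= T / 2 by rewrite /d ge_min lexx orbT.
(* The nearby point is taken on the side of [t] that leaves room of length [T / 2]. *)
have [tT2|tT2] := leP t (T / 2).
- exists (t + d); apply: he => /=.
  + by rewrite opprD addrA subrr add0r normrN gtr0_norm.
  + by rewrite -subr_eq0 addrAC subrr add0r gt_eqF.
  + by apply/andP; split; lra.
- exists (t - d); apply: he => /=.
  + by rewrite opprB addrCA subrr addr0 gtr0_norm.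
  + by rewrite -subr_eq0 addrAC subrr add0r oppr_eq0 gt_eqF.
  + by apply/andP; split; lra.
Qed.

(** Continuity at every point, ends included, follows from boundedness of the quotient near that
    point; at interior points small steps of either sign stay in [[0, T]]. *)
Lemma derivative_on_quotient f g :
  (forall t, 0 <= t <= T ->
    (fun s => (f s - f t) / (s - t)) @
      within [set s : R | 0 <= s <= T] t^' --> g t) ->
  derivative_on f g.
Proof.
move=> q; split.
  apply/subspace_continuousP => t /=; rewrite in_itv/= => tT.
  have /cvgrPdist_lt qt := q t tT.
  apply/cvgrPdist_lt => e e0.
  have [d1 /= d10 h1] := qt 1 ltr01.
  (* Closer than [d1] the quotient is within 1 of [g t], so [f] varies by at most
     $(|g(t)|+1)|s-t|$. *)
  pose d := Num.min d1 (e / (`|g t| + 1)).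
  have g1 : 0 < `|g t| + 1 by rewrite ltr_wpDl.
  exists d; first by rewrite /= lt_min d10 divr_gt0.
  move=> s /=; rewrite lt_min => /andP[sd1 sde] sT; rewrite in_itv/= in sT.
  have [->|st] := eqVneq s t; first by rewrite subrr normr0.
  have := h1 s sd1 st sT; set Q := (f s - f t) / (s - t) => hQ.
  have -> : f t - f s = Q * (t - s).
    by rewrite /Q -[t - s]opprB mulrN divfK ?opprB// subr_eq0.
  have Qg : `|Q| < `|g t| + 1.
    rewrite -(subrK (g t) Q) addrC (le_lt_trans (ler_normD _ _))// ltrD2l.
    by rewrite distrC.
  rewrite normrM (@le_lt_trans _ _ ((`|g t| + 1) * `|t - s|))//.
    by rewrite ler_wpM2r// ltW.
  by rewrite mulrC -ltr_pdivlMr.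
move=> t; rewrite in_itv/= => /andP[t0 tT].
have tT' : 0 <= t <= T by rewrite !ltW.
have qt := q t tT'.
have cv : h^-1 *: (f (h *: 1 + t) - f t) @[h --> 0^'] --> g t.
  apply/cvgrPdist_lt => e e0; move/cvgrPdist_lt : qt => /(_ e e0)[d /= d0 hd].
  (* The bounds [t] and [T - t] on the step keep [h + t] in [[0, T]]. *)
  exists (Num.min d (Num.min t (T - t))) => /=.
    by rewrite !lt_min d0 t0 subr_gt0 tT.
  move=> h /=; rewrite sub0r normrN !lt_min => /and3P[hd1 ht hT] h0.
  have -> : h *: (1 : R) + t = h + t by rewrite /GRing.scale /= mulr1.
  have := hd (h + t); rewrite /= addrK mulrC; apply.
  - by rewrite opprD addrCA subrr addr0 normrN.
  - by rewrite -subr_eq0 addrK.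
  - move: ht hT; rewrite !ltr_norml => /andP[? ?] /andP[? ?].
    by apply/andP; split; lra.
by apply: DeriveDef; [apply/cvg_ex; exists (g t)|exact/cvg_lim].
Qed.

End Calculus.

(** * Energy estimate in coordinates *)

Section BilinearForms.
Context {R : realType} {X : finType}.
Implicit Types (S A P : X -> X -> R) (u v w : X -> R).

(** This is $u^T S v$, indexed by an arbitrary finite type so that degrees of freedom can serve as
    indices directly. *)
Definition mxform S u v : R := \sum_q \sum_r S q r * u q * v r.

Definition mxapp P u : X -> R := fun q => \sum_r P q r * u r.

Lemma mxformDl S u v w :
  mxform S (fun q => u q + v q) w = mxform S u w + mxform S v w.
Proof.
rewrite /mxform -big_split; apply: eq_bigr => q _; rewrite -big_split.
by apply: eq_bigr => r _; rewrite mulrDr mulrDl.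
Qed.

Lemma mxformZl S (c : R) u v :
  mxform S (fun q => c * u q) v = c * mxform S u v.
Proof.
rewrite /mxform mulr_sumr; apply: eq_bigr => q _; rewrite mulr_sumr.
by apply: eq_bigr => r _; ring.
Qed.

Lemma mxformBl S u v w :
  mxform S (fun q => u q - v q) w = mxform S u w - mxform S v w.
Proof.
rewrite -[X in _ + X]mulN1r -mxformZl -mxformDl.
by congr (mxform S _ w); apply/funext => q; rewrite mulN1r.
Qed.

Lemma derivative_on_mxform (T : R) S (u v u' v' : R -> X -> R) :
  (forall q, derivative_on T (u^~ q) (u'^~ q)) ->
  (forall q, derivative_on T (v^~ q) (v'^~ q)) ->
  derivative_on T (fun t => mxform S (u t) (v t))
    (fun t => mxform S (u' t) (v t) + mxform S (u t) (v' t)).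
Proof.
move=> du dv.
have -> : (fun t => mxform S (u' t) (v t) + mxform S (u t) (v' t)) =
    (fun t => \sum_q \sum_r
      (S q r * u' t q * v t r + S q r * u t q * v' t r)).
  apply/funext => t; rewrite /mxform -big_split; apply: eq_bigr => q _.
  by rewrite -big_split.
do 2 (apply: derivative_on_sum => ?); apply: derivative_onM => //.
exact: derivative_onZ.
Qed.

Lemma within_continuous_mxform S (D : set R) (u v : R -> X -> R) :
  (forall q, {within D, continuous u^~ q}) ->
  (forall q, {within D, continuous v^~ q}) ->
  {within D, continuous fun t => mxform S (u t) (v t)}.
Proof.
move=> cu cv; do 2 (apply: within_continuous_sum => ?).
apply: within_continuousM => //; apply: within_continuousM => //.
exact: within_continuous_cst.
Qed.

Lemma mxformNl S u v : mxform S (fun q => - u q) v = - mxform S u v.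
Proof.
rewrite -mulN1r -mxformZl; congr (mxform S _ v).
by apply/funext => q; rewrite mulN1r.
Qed.

Lemma mxform0r S u : mxform S u (fun=> 0) = 0.
Proof. by rewrite /mxform big1// => q _; rewrite big1// => r _; rewrite mulr0. Qed.

Lemma mxappB P u v :
  mxapp P (fun q => u q - v q) = fun q => mxapp P u q - mxapp P v q.
Proof.
apply/funext => q; rewrite /mxapp -sumrB.
by apply: eq_bigr => r _; rewrite mulrBr.
Qed.

(** * The seminorm of a symmetric positive semidefinite form *)

Section Seminorm.
Variable S : X -> X -> R.
Hypothesis S_sym : forall u v, mxform S u v = mxform S v u.
Hypothesis S_psd : forall u, 0 <= mxform S u u.

Definition mxnorm u : R := Num.sqrt (mxform S u u).

Lemma mxnorm_ge0 u : 0 <= mxnorm u. Proof. exact: sqrtr_ge0. Qed.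

Lemma mxnormK u : mxnorm u ^+ 2 = mxform S u u.
Proof. exact: sqr_sqrtr. Qed.

Lemma mxform_lincomb (b c : R) u v :
  mxform S (fun q => b * u q + c * v q) (fun q => b * u q + c * v q) =
  b ^+ 2 * mxform S u u + b * c * mxform S u v *+ 2 + c ^+ 2 * mxform S v v.
Proof.
rewrite mxformDl !mxformZl S_sym (S_sym v) !mxformDl !mxformZl (S_sym v u).
by ring.
Qed.

(** A suitable combination of [u] and [v] has nonnegative square. As the form is only semidefinite,
    a [v] of seminorm zero is treated separately. *)
Lemma mxform_CauchySchwarz u v : mxform S u v <= mxnorm u * mxnorm v.
Proof.
rewrite (le_trans (ler_norm _))// -(@ler_pXn2r _ 2)// ?nnegrE//; last first.
  by rewrite mulr_ge0// mxnorm_ge0.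
rewrite exprMn !mxnormK real_normK ?num_real//.
have [c0|c0] := eqVneq (mxform S v v) 0.
- suff -> : mxform S u v = 0 by rewrite c0 mulr0 expr0n.
  apply/eqP; apply: contraT => b0.
  (* The coefficient of [v] is chosen so that the square of the combination would be -1. *)
  have := S_psd (fun q => 1 * u q +
    (- (mxform S u u + 1) / (mxform S u v *+ 2)) * v q).
  rewrite mxform_lincomb c0 mulr0 addr0.
  have -> : 1 ^+ 2 * mxform S u u + 1 * (- (mxform S u u + 1) / (mxform S u v *+ 2))
      * mxform S u v *+ 2 = - 1 by field.
  by rewrite lerNr oppr0 ler10.
- have c1 : 0 < mxform S v v by rewrite lt_def c0 S_psd.
  (* The square of this combination is $S(v,v)\,(S(u,u)S(v,v)-S(u,v)^2)$. *)
  have := S_psd (fun q => mxform S v v * u q + (- mxform S u v) * v q).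
  rewrite mxform_lincomb.
  have -> : mxform S v v ^+ 2 * mxform S u u +
     mxform S v v * - mxform S u v * mxform S u v *+ 2 +
     (- mxform S u v) ^+ 2 * mxform S v v =
     mxform S v v * (mxform S u u * mxform S v v - mxform S u v ^+ 2) by ring.
  by rewrite pmulr_rge0// subr_ge0.
Qed.

(** Stated for a difference because the error splits as $\varepsilon=\eta-\xi$; it follows from
    Cauchy-Schwarz for [-u] and [v]. *)
Lemma mxnormB u v : mxnorm (fun q => u q - v q) <= mxnorm u + mxnorm v.
Proof.
rewrite -(@ler_pXn2r _ 2)// ?nnegrE ?addr_ge0 ?mxnorm_ge0//.
rewrite mxnormK sqrrD !mxnormK.
have -> : (fun q => u q - v q) = (fun q => 1 * u q + (-1) * v q).
  by apply/funext => q; rewrite mul1r mulN1r.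
rewrite mxform_lincomb.
have := mxform_CauchySchwarz (fun q => (-1) * u q) v.
have -> : mxnorm (fun q => (-1) * u q) = mxnorm u.
  by rewrite /mxnorm mxformZl S_sym mxformZl mulrA mulrNN !mul1r.
by rewrite mxformZl; lra.
Qed.

Lemma within_continuous_mxnorm (D : set R) (u : R -> X -> R) :
  (forall q, {within D, continuous u^~ q}) ->
  {within D, continuous fun t => mxnorm (u t)}.
Proof.
move=> cu; apply/subspace_continuousP => t Dt.
apply: (@cvg_comp _ _ _ (fun s => mxform S (u s) (u s)) Num.sqrt); last first.
  exact: sqrt_continuous.
by move/subspace_continuousP : (@within_continuous_mxform S D u u cu cu); exact.
Qed.

End Seminorm.

(* [u], [w] and [y1], [y2] are the coordinates of [u_H], [w_H] and of the first
   two time derivatives of [u_h]; [P] projects onto the coordinates of [V_H], so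
   that the time integral of a path in [V] stays in [V]. *)
Lemma wave_energy_estimate (T : R) S A P (V : set (X -> R))
    (y1 y2 u u1 u2 w w1 : R -> X -> R) :
  0 < T ->
  (forall u v, mxform S u v = mxform S v u) -> (forall u, 0 <= mxform S u u) ->
  (forall u v, mxform A u v = mxform A v u) ->
  (forall v, V v -> 0 <= mxform A v v) ->
  (forall v, V (mxapp P v)) -> (forall v, V v -> mxapp P v = v) ->
  (forall q, derivative_on T (y1^~ q) (y2^~ q)) ->
  (forall q, derivative_on T (u^~ q) (u1^~ q)) ->
  (forall q, derivative_on T (u1^~ q) (u2^~ q)) ->
  (forall q, derivative_on T (w^~ q) (w1^~ q)) ->
  (forall q, {within `[0, T], continuous w1^~ q}) ->
  (forall t, 0 <= t <= T -> V (u t)) -> (forall t, 0 <= t <= T -> V (w t)) ->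
  (forall t v, 0 <= t <= T -> V v ->
    mxform S (u2 t) v + mxform A (u t) v =
    mxform S (y2 t) v + mxform A (w t) v) ->
  (forall v, V v -> mxform S (u1 0) v = mxform S (y1 0) v) ->
  forall t, 0 <= t <= T ->
  mxnorm S (fun q => u t q - w t q) <= mxnorm S (fun q => u 0 q - w 0 q) +
   2 * \int[lebesgue_measure]_(t in `[0, T]) mxnorm S (fun q => y1 t q - w1 t q).
Proof.
move=> T0 Ssym Spsd Asym Apsd VP PV dy1 du du1 dw cw1 Vu Vw eqn init.
pose xi t q := u t q - w t q.
pose xi1 t q := u1 t q - w1 t q.
pose N t := mxnorm S (fun q => y1 t q - w1 t q).
have dxi q : derivative_on T (xi^~ q) (xi1^~ q) by exact: derivative_onB.
have cxi q : {within `[0, T], continuous xi^~ q} by have [] := dxi q.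
have cN : {within `[0, T], continuous N}.
  apply: within_continuous_mxnorm => // q t; apply: cvgB; last exact: cw1.
  by have [+ _] := dy1 q; apply.
have Pxi t : 0 <= t <= T -> mxapp P (xi t) = xi t.
  by move=> tT; rewrite mxappB (PV _ (Vu _ tT)) (PV _ (Vw _ tT)).
(* A bound at a maximizer of the norm of [xi] is a bound at all times. *)
have [tau] := EVT_max (ltW T0) (@within_continuous_mxnorm S _ xi cxi).
rewrite in_itv/= => tauT Mtau.
set M := mxnorm S (xi tau) in Mtau.
pose H q t := \int[lebesgue_measure]_(s in `[0, t]) xi s q.
have dH q : derivative_on T (H q) (xi^~ q) by exact: derivative_on_antiderivative.
pose G t := \int[lebesgue_measure]_(s in `[0, t]) N s.
have dG : derivative_on T G N by exact: derivative_on_antiderivative.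
(* The test path $\int_t^\tau\xi$. Applying [P] puts it in [V], and leaves the derivative [- xi]
   unchanged because [xi] takes values in [V]. *)
pose phi t := mxapp P (fun q => H q tau - H q t).
have dphi q : derivative_on T (phi^~ q) (fun t => mxapp P (fun r => 0 - xi t r) q).
  apply: derivative_on_sum => r; apply: derivative_onZ; apply: derivative_onB => //.
  exact: derivative_on_cst.
have phi'E t : 0 <= t <= T -> mxapp P (fun r => 0 - xi t r) = fun q => - xi t q.
  move=> tT; rewrite -[in RHS](Pxi t tT); apply/funext => q.
  by rewrite /mxapp -sumrN; apply: eq_bigr => r _; rewrite sub0r mulrN.
have Vphi t : V (phi t) by exact: VP.
(* The energy of the duality argument, lowered by [M * G t] so that it becomes nonincreasing on
   [[0, tau]]. *)
pose E t := mxform S (fun q => u1 t q - y1 t q) (phi t) +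
  2^-1 * mxform S (xi t) (xi t) - 2^-1 * mxform A (phi t) (phi t) - M * G t.
have dE := derivative_onB (derivative_onB (derivative_onD
    (@derivative_on_mxform T S _ _ _ _ (fun q => derivative_onB (du1 q) (dy1 q)) dphi)
    (derivative_onZ 2^-1 (@derivative_on_mxform T S _ _ _ _ dxi dxi)))
  (derivative_onZ 2^-1 (@derivative_on_mxform T A _ _ _ _ dphi dphi)))
  (derivative_onZ M dG).
have E_le : E tau <= E 0.
  apply: (derivative_on_le (lexx 0) _ _ dE) => [||t]; [by case/andP: tauT..|].
  move=> /andP[t0 ttau].
  have tT : 0 <= t <= T.
    by rewrite ltW//= ltW// (lt_le_trans ttau)//; case/andP : tauT.
  (* The symmetries bring all terms to a common shape. The error equation tested with [phi t]
     cancels the terms in [A]; what remains is $S(y_1-w_1,\xi)-M N(t)$, nonpositive by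
     Cauchy-Schwarz and the choice of [M]. *)
  rewrite (phi'E t tT) [mxform S (xi t) (xi1 t)]Ssym.
  rewrite [mxform S _ (fun q => - xi t q)]Ssym.
  rewrite [mxform A (phi t) _]Asym !mxformNl [mxform S (xi t) _]Ssym.
  have := eqn t (phi t) tT (Vphi t).
  have := mxform_CauchySchwarz Ssym Spsd (fun q => y1 t q - w1 t q) (xi t).
  rewrite -/(N t).
  have : N t * mxnorm S (xi t) <= N t * M.
    by rewrite ler_wpM2l ?mxnorm_ge0// Mtau// in_itv.
  have h1 : mxform A (xi t) (phi t) = mxform A (u t) (phi t) - mxform A (w t) (phi t).
    exact: mxformBl.
  have h2 : mxform S (xi1 t) (xi t) = mxform S (u1 t) (xi t) - mxform S (w1 t) (xi t).
    exact: mxformBl.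
  rewrite h1 h2 !mxformBl (mulrC M).
  move: (N t * M) (N t * mxnorm S (xi t)) => *; lra.
have phi_tau : phi tau = fun=> 0.
  by apply/funext => q; rewrite /phi /mxapp big1// => r _; rewrite subrr mulr0.
have G0 : G 0 = 0 by rewrite /G set_itv1 Rintegral_set1.
(* The integrand [N] is nonnegative, so [-G] is nonincreasing. *)
have GT : G tau <= G T.
  rewrite -lerN2 -[- G T]mulN1r -[- G tau]mulN1r.
  apply: (derivative_on_le _ _ (lexx T) (derivative_onZ (-1) dG)) => [||x _].
  - by case/andP : tauT.
  - by case/andP : tauT.
  - by rewrite mulN1r oppr_le0 mxnorm_ge0.
move=> t tT; apply: (le_trans (Mtau t _)); first by rewrite in_itv.
(* The first term of [E 0] vanishes by the choice of initial velocities, and the [A] term enters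
   with a favourable sign. *)
have E0 : E 0 <= 2^-1 * mxnorm S (xi 0) ^+ 2.
  rewrite /E mxformBl init// G0 mulr0 subr0 subrr add0r mxnormK//.
  by rewrite gerBl mulr_ge0// Apsd.
have Etau : E tau = 2^-1 * M ^+ 2 - M * G tau.
  by rewrite /E phi_tau !mxform0r mulr0 subr0 add0r -mxnormK.
have xi0 : mxnorm S (xi 0) <= M by apply: Mtau; rewrite in_itv/= lexx ltW.
have xi00 : 0 <= mxnorm S (xi 0) by exact: mxnorm_ge0.
have GT0 : 0 <= G T by apply: Rintegral_ge0 => s _; exact: mxnorm_ge0.
change (M <= mxnorm S (xi 0) + 2 * G T).
(* For [M > 0] the goal is multiplied by [M]: since $|\xi(0)|\le M$, the energy inequality gives
   $M^2\le M|\xi(0)|+2MG(T)$. *)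
have [M0|M0] := eqVneq M 0; first by rewrite M0 addr_ge0// mulr_ge0.
have {M0} M0 : 0 < M by rewrite lt_def M0 mxnorm_ge0.
rewrite -(ler_pM2l M0); move: E_le; rewrite Etau => E_le.
have : M * G tau <= M * G T by rewrite ler_pM2l.
have : mxnorm S (xi 0) ^+ 2 <= M * mxnorm S (xi 0) by rewrite expr2 ler_wpM2r.
rewrite mulrDr -expr2 mulrCA.
move: (E 0) (M * G T) (M * G tau) (M ^+ 2) (mxnorm S (xi 0) ^+ 2) E0 E_le => *; lra.
Qed.

End BilinearForms.

(** * Geometry of the mesh *)

Lemma lebesgue_itv_finite {R : realType} (a b : R) :
  (lebesgue_measure (`[a, b]%classic : set R) < +oo)%E.
Proof.
by rewrite lebesgue_measure_itv/=; case: ifP => // _; rewrite -EFinD ltry.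
Qed.

Section MeshGeometry.
Context {R : realType} {Om : set (R * R)} (M : mesh Om).
Local Notation cell := 'I_(ncell M).
Local Notation rect := (rect (@lo R Om M) (@hi R Om M)).
Local Notation orect := (orect (@lo R Om M) (@hi R Om M)).

Lemma rectE (i : cell) :
  rect i = `[(lo i).1, (hi i).1]%classic `*` `[(lo i).2, (hi i).2]%classic.
Proof. by apply/seteqP; split=> x /=; rewrite !in_itv. Qed.

Lemma orectE (i : cell) :
  orect i = `](lo i).1, (hi i).1[%classic `*` `](lo i).2, (hi i).2[%classic.
Proof. by apply/seteqP; split=> x /=; rewrite !in_itv. Qed.

Lemma open_orect (i : cell) : open (orect i).
Proof.
rewrite orectE; apply: openI.
  by apply: open_comp; [move=> x _; exact: cvg_fst|exact: interval_open].
by apply: open_comp; [move=> x _; exact: cvg_snd|exact: interval_open].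
Qed.

Lemma closed_rect (i : cell) : closed (rect i).
Proof.
rewrite rectE; apply: closedI.
  by apply: closed_comp; [move=> x _; exact: cvg_fst|exact: interval_closed].
by apply: closed_comp; [move=> x _; exact: cvg_snd|exact: interval_closed].
Qed.

Lemma measurable_rect (i : cell) : measurable (rect i).
Proof. by rewrite rectE; exact: measurableX. Qed.

Lemma measurable_orect (i : cell) : measurable (orect i).
Proof. by rewrite orectE; exact: measurableX. Qed.

(** An open subset of the union of the closed cells lies in the interior of that union, which is
    [Om]. *)
Lemma orect_sub_domain (i : cell) : orect i `<=` Om.
Proof.
suff : orect i `<=` interior (\bigcup_(j in [set: cell]) rect j).
  by rewrite -(mesh_cover M).
rewrite -open_subsetE; last exact: open_orect.
move=> x [/andP[x1 x2] /andP[x3 x4]]; exists i => //.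
by split; rewrite !ltW.
Qed.

Lemma near_open_interval (a b x e : R) : a < b -> a <= x <= b -> 0 < e ->
  exists y, a < y < b /\ `|x - y| < e.
Proof.
move=> ab /andP[ax xb] e0.
pose d := Num.min (e / 2) ((b - a) / 4).
have d0 : 0 < d by rewrite /d lt_min !divr_gt0// subr_gt0.
have de : d < e by rewrite /d gt_min; apply/orP; left; lra.
have dab : d <= (b - a) / 4 by rewrite /d ge_min lexx orbT.
have [xm|xm] := leP x ((a + b) / 2).
- exists (x + d); split; first by apply/andP; split; lra.
  by rewrite opprD addrA subrr add0r normrN gtr0_norm.
- exists (x - d); split; first by apply/andP; split; lra.
  by rewrite opprB addrCA subrr addr0 gtr0_norm.
Qed.

(** Cells are nondegenerate, so each point of one is approached, coordinate by coordinate, from its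
    open part. *)
Lemma rect_sub_closure (i : cell) : rect i `<=` closure Om.
Proof.
move=> x [x1 x2] U /nbhs_ballP[e /= e0 eU].
have [lh1 lh2] := mesh_nondeg i.
have [y1 [y11 y12]] := near_open_interval lh1 x1 e0.
have [y2 [y21 y22]] := near_open_interval lh2 x2 e0.
exists (y1, y2); split; first by apply: (@orect_sub_domain i); split.
by apply: eU; split.
Qed.

(** A finite union of closed cells is closed. This set contains all cells and sides, and the
    coefficient is controlled on it, so it is the common domain of all integrands. *)
Lemma closure_mesh : closure Om = \bigcup_(i in [set: cell]) rect i.
Proof.
apply/seteqP; split; last by move=> x [i _]; exact: rect_sub_closure.
have cl : closed (\bigcup_(i in [set: cell]) rect i).
  by apply: closed_bigcup => [|i _]; [exact: finite_finset|exact: closed_rect].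
rewrite [X in _ `<=` X](closure_id _).1//; apply: closureS.
by apply: subset_trans (@interior_subset _ _); rewrite -(mesh_cover M).
Qed.

Lemma measurable_closure_mesh : measurable (closure Om).
Proof.
rewrite closure_mesh; apply: fin_bigcup_measurable => [|i _].
  exact: finite_finset.
exact: measurable_rect.
Qed.

Definition mesh_bound : R :=
  \sum_(i < ncell M) (`|(lo i).1| + `|(hi i).1| + `|(lo i).2| + `|(hi i).2|).

Lemma closure_mesh_bounded x : closure Om x ->
  `|x.1| <= mesh_bound /\ `|x.2| <= mesh_bound.
Proof.
rewrite closure_mesh => -[i _ [/andP[a1 a2] /andP[a3 a4]]].
rewrite /mesh_bound (bigD1 i)//=.
set s := \sum_(j < _ | _) _.
have s0 : 0 <= s by apply: sumr_ge0 => j _; rewrite !addr_ge0.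
have := ler_norm (- (lo i).1); have := ler_norm ((hi i).1).
have := ler_norm (- (lo i).2); have := ler_norm ((hi i).2).
rewrite !normrN => h1 h2 h3 h4.
have := normr_ge0 (lo i).1; have := normr_ge0 (lo i).2.
have := normr_ge0 (hi i).1; have := normr_ge0 (hi i).2 => *.
by rewrite !ler_norml; split; apply/andP; split; lra.
Qed.

Lemma closure_mesh_finite :
  ((lebesgue_measure \x lebesgue_measure)%E (closure Om) < +oo)%E.
Proof.
pose b : set R := `[- mesh_bound, mesh_bound]%classic.
have mb : measurable b by exact: measurable_itv.
apply: (@le_lt_trans _ _ ((lebesgue_measure \x lebesgue_measure)%E (b `*` b))).
  apply: le_measure; rewrite ?inE.
  - exact: measurable_closure_mesh.
  - exact: measurableX.
  - move=> x /closure_mesh_bounded[]; rewrite !ler_norml.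
    by split; rewrite /b/= in_itv.
rewrite product_measure1E//.
by apply: lte_mul_pinfty; rewrite ?ge0_fin_numE//; exact: lebesgue_itv_finite.
Qed.

End MeshGeometry.

(** * Integrals of bilinear expressions *)

Section BoundedMeasurable.
Context d {T : measurableType d} {R : realType}.
Variable D : set T.
Implicit Types f g : T -> R.

(** A class closed under sums, products and composition with measurable maps, whose members are
    integrable on measurable sets of finite measure. *)
Definition bounded_measurable f : Prop :=
  measurable_fun D f /\ exists b : R, forall x, D x -> `|f x| <= b.

Lemma bounded_measurable_cst (c : R) : bounded_measurable (fun=> c).
Proof. by split; [exact: measurable_cst|exists `|c|]. Qed.

Lemma bounded_measurableD f g : bounded_measurable f -> bounded_measurable g ->
  bounded_measurable (fun x => f x + g x).
Proof.
move=> [mf [b hb]] [mg [c hc]]; split; first exact: measurable_funD.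
by exists (b + c) => x Dx; rewrite (le_trans (ler_normD _ _))// lerD ?hb ?hc.
Qed.

Lemma bounded_measurableM f g : bounded_measurable f -> bounded_measurable g ->
  bounded_measurable (fun x => f x * g x).
Proof.
move=> [mf [b hb]] [mg [c hc]]; split; first exact: measurable_funM.
by exists (b * c) => x Dx; rewrite normrM ler_pM ?hb ?hc.
Qed.

Lemma bounded_measurable_sum (I : Type) (r : seq I) (F : I -> T -> R) :
  (forall i, bounded_measurable (F i)) ->
  bounded_measurable (fun x => \sum_(i <- r) F i x).
Proof.
move=> hF; elim: r => [|i r ih].
  by under eq_fun do rewrite big_nil; exact: bounded_measurable_cst.
by under eq_fun do rewrite big_cons; exact: bounded_measurableD.
Qed.

Lemma bounded_measurable_indic (A : set T) : measurable A ->
  bounded_measurable (\1_A).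
Proof.
move=> mA; split; first exact: measurable_indic.
by exists 1 => x _; rewrite indicE; case: (x \in A); rewrite ?normr1 ?normr0.
Qed.

Lemma bounded_measurable_integrable (mu : {measure set T -> \bar R}) f :
  measurable D -> (mu D < +oo)%E -> bounded_measurable f ->
  mu.-integrable D (EFin \o f).
Proof.
move=> mD Dfin [mf [b hb]]; apply: measurable_bounded_integrable => //.
exists b; split; first exact: num_real.
by move=> c bc x Dx; exact: le_trans (hb x Dx) (ltW bc).
Qed.

End BoundedMeasurable.

Lemma bounded_measurable_comp d1 d2 (T1 : measurableType d1)
    (T2 : measurableType d2) (R : realType) (D1 : set T1) (D2 : set T2)
    (p : T1 -> T2) (f : T2 -> R) :
  measurable D2 -> measurable_fun D1 p -> p @` D1 `<=` D2 ->
  bounded_measurable D2 f -> bounded_measurable D1 (f \o p).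
Proof.
move=> mD2 mp pD [mf [b hb]]; split; first exact: (measurable_comp mD2).
by exists b => x Dx; apply: hb; apply: pD; exists x.
Qed.

Lemma Rintegral_sum d (T : measurableType d) (R : realType)
    (mu : {measure set T -> \bar R}) (D : set T) (I : Type) (r : seq I)
    (F : I -> T -> R) :
  measurable D -> (forall i, mu.-integrable D (EFin \o F i)) ->
  \int[mu]_(x in D) (\sum_(i <- r) F i x) =
  \sum_(i <- r) \int[mu]_(x in D) F i x.
Proof.
move=> mD iF; elim: r => [|i r ih].
  rewrite big_nil; under eq_Rintegral do rewrite big_nil.
  by rewrite Rintegral_cst// mul0r.
rewrite big_cons -ih; under eq_Rintegral do rewrite big_cons.
rewrite RintegralD//.
have -> : EFin \o (fun x => \sum_(j <- r) F j x) =
    (fun x => (\sum_(j <- r) (EFin \o F j) x)%E).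
  by apply/funext => x; rewrite /= sumEFin.
exact: integrable_sum.
Qed.

(** * Integrands that depend linearly or bilinearly on coordinates *)

Section PointwiseForms.
Context {X : finType} {R : realType}.

(** The coefficient functions do not depend on [u], so integrating a product of two such expressions
    yields a fixed matrix. *)
Definition pointwise_linear d (T : measurableType d) (D : set T)
    (A : (X -> R) -> T -> R) : Prop :=
  exists alpha : X -> T -> R, (forall q, bounded_measurable D (alpha q)) /\
    forall u x, A u x = \sum_q alpha q x * u q.

Definition pointwise_bilinear d (T : measurableType d) (D : set T)
    (K : (X -> R) -> (X -> R) -> T -> R) : Prop :=
  exists kappa : X -> X -> T -> R,
    (forall q r, bounded_measurable D (kappa q r)) /\
    forall u v x, K u v x = \sum_q \sum_r kappa q r x * u q * v r.

Section Pointwise.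
Context d {T : measurableType d}.
Variable D : set T.
Implicit Types (A B : (X -> R) -> T -> R) (K L : (X -> R) -> (X -> R) -> T -> R).

Lemma pointwise_linear_coord q : pointwise_linear D (fun u _ => u q).
Proof.
exists (fun r _ => (r == q)%:R); split=> [r|u x].
  exact: bounded_measurable_cst.
rewrite (bigD1 q)//= eqxx mul1r big1 ?addr0// => r /negPf ->.
by rewrite mul0r.
Qed.

Lemma pointwise_linearM (f : T -> R) A : bounded_measurable D f ->
  pointwise_linear D A -> pointwise_linear D (fun u x => f x * A u x).
Proof.
move=> hf [al [hal EA]]; exists (fun q x => f x * al q x); split=> [q|u x].
  exact: bounded_measurableM.
by rewrite EA mulr_sumr; apply: eq_bigr => q _; rewrite mulrA.
Qed.

Lemma pointwise_linearD A B : pointwise_linear D A -> pointwise_linear D B ->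
  pointwise_linear D (fun u x => A u x + B u x).
Proof.
move=> [al [hal EA]] [be [hbe EB]].
exists (fun q x => al q x + be q x); split=> [q|u x].
  exact: bounded_measurableD.
by rewrite EA EB -big_split; apply: eq_bigr => q _; rewrite mulrDl.
Qed.

Lemma pointwise_linearB A B : pointwise_linear D A -> pointwise_linear D B ->
  pointwise_linear D (fun u x => A u x - B u x).
Proof.
move=> hA /(pointwise_linearM (bounded_measurable_cst D (-1))) hB.
have := pointwise_linearD hA hB; congr (pointwise_linear D _).
by apply/funext => u; apply/funext => x; rewrite mulN1r.
Qed.

Lemma pointwise_linear_sum (I : Type) (r : seq I) (F : I -> (X -> R) -> T -> R) :
  (forall i, pointwise_linear D (F i)) ->
  pointwise_linear D (fun u x => \sum_(i <- r) F i u x).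
Proof.
move=> hF; elim: r => [|i r ih].
  exists (fun _ _ => 0); split=> [q|u x]; first exact: bounded_measurable_cst.
  by rewrite big_nil big1// => q _; rewrite mul0r.
have := pointwise_linearD (hF i) ih; congr (pointwise_linear D _).
by apply/funext => u; apply/funext => x; rewrite big_cons.
Qed.

Lemma pointwise_bilinear_prod A B :
  pointwise_linear D A -> pointwise_linear D B ->
  pointwise_bilinear D (fun u v x => A u x * B v x).
Proof.
move=> [al [hal EA]] [be [hbe EB]].
exists (fun q r x => al q x * be r x); split=> [q r|u v x].
  exact: bounded_measurableM.
rewrite EA EB mulr_suml; apply: eq_bigr => q _; rewrite mulr_sumr.
by apply: eq_bigr => r _; ring.
Qed.

Lemma pointwise_bilinearD K L :
  pointwise_bilinear D K -> pointwise_bilinear D L ->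
  pointwise_bilinear D (fun u v x => K u v x + L u v x).
Proof.
move=> [ka [hka EK]] [la [hla EL]].
exists (fun q r x => ka q r x + la q r x); split=> [q r|u v x].
  exact: bounded_measurableD.
rewrite EK EL -big_split; apply: eq_bigr => q _; rewrite -big_split.
by apply: eq_bigr => r _; rewrite /= !mulrDl.
Qed.

(** The matrix entries are the integrals of the coefficient functions, which are bounded on a set of
    finite measure. *)
Lemma Rintegral_pointwise_bilinear (mu : {measure set T -> \bar R}) K :
  measurable D -> (mu D < +oo)%E -> pointwise_bilinear D K ->
  exists S, forall u v, \int[mu]_(x in D) K u v x = mxform S u v.
Proof.
move=> mD Dfin [ka [hka EK]].
exists (fun q r => \int[mu]_(x in D) ka q r x) => u v.
have bm q r : bounded_measurable D (fun x => ka q r x * u q * v r).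
  by do 2 (apply: bounded_measurableM; last exact: bounded_measurable_cst).
under eq_Rintegral do rewrite EK.
rewrite Rintegral_sum//; last first.
  move=> q; apply: bounded_measurable_integrable => //.
  exact: bounded_measurable_sum.
apply: eq_bigr => q _; rewrite Rintegral_sum//; last first.
  by move=> r; exact: bounded_measurable_integrable.
apply: eq_bigr => r _; rewrite !RintegralZr//.
- exact: bounded_measurable_integrable.
- apply: bounded_measurable_integrable => //.
  by apply: bounded_measurableM => //; exact: bounded_measurable_cst.
Qed.

End Pointwise.

(** Serves twice: with [p] the identity to restrict to a cell, and with [p] the parametrization of a
    side to reach edge integrals. *)
Lemma pointwise_bilinear_comp d1 d2 (T1 : measurableType d1)
    (T2 : measurableType d2) (D1 : set T1) (D2 : set T2) (p : T1 -> T2) K :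
  measurable D2 -> measurable_fun D1 p -> p @` D1 `<=` D2 ->
  pointwise_bilinear D2 K -> pointwise_bilinear D1 (fun u v x => K u v (p x)).
Proof.
move=> mD2 mp pD [ka [hka EK]].
exists (fun q r => ka q r \o p); split=> [q r|u v x]; last by rewrite EK.
exact: bounded_measurable_comp (hka q r).
Qed.

End PointwiseForms.

(** * Coordinates of piecewise bilinear functions *)

Section NodalBasis.
Context {R : realType}.

(** The pieces are polynomials on the whole plane, so the unit square can serve as reference square
    for every cell. *)
Definition node (c : bool * bool) : R * R := ((c.1 : nat)%:R, (c.2 : nat)%:R).

Definition shape (c : bool * bool) (x : R * R) : R :=
  (if c.1 then x.1 else 1 - x.1) * (if c.2 then x.2 else 1 - x.2).

Lemma big_bool2 (F : bool * bool -> R) :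
  \sum_c F c = F (true, true) + F (true, false) +
    (F (false, true) + F (false, false)).
Proof.
have -> : \sum_c F c = \sum_(a : bool) \sum_(b : bool) F (a, b).
  by rewrite pair_bigA; apply: eq_bigr => -[].
by rewrite !big_bool.
Qed.

(** Four nodal values determine a bilinear polynomial. In this form the property passes to linear
    combinations and to pointwise limits. *)
Lemma bilinear_polyP (g : R * R -> R) :
  bilinear_poly g <-> forall x, g x = \sum_c shape c x * g (node c).
Proof.
split=> [[c0 [c1 [c2 [c3 gE]]]] x|gE].
  by rewrite big_bool2 /shape /node !gE /=; ring.
exists (g (node (false, false))),
  (g (node (true, false)) - g (node (false, false))),
  (g (node (false, true)) - g (node (false, false))),
  (g (node (true, true)) - g (node (true, false)) - g (node (false, true))
   + g (node (false, false))) => x.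
by rewrite [LHS]gE big_bool2 /shape /=; ring.
Qed.

(** Along an axis direction the quadratic term in [h] drops out, so the difference quotient is
    constant. *)
Lemma bilinear_directional_derivative (w : bool * bool -> R) (v x : R * R)
    (l : R) :
  (forall h, \sum_c shape c (h *: v + x) * w c -
             \sum_c shape c x * w c = h * l + h ^+ 2 * (v.1 * v.2) *
    (w (true, true) - w (true, false) - w (false, true) + w (false, false))) ->
  v.1 * v.2 = 0 ->
  'D_v (fun y => \sum_c shape c y * w c) x = l.
Proof.
move=> E v0; apply/cvg_lim => //; apply: cvg_near_cst.
near=> h; have h0 : h != 0 by near: h; exact: nbhs_dnbhs_neq.
by rewrite E v0 mulr0 mul0r addr0 /GRing.scale /= mulKf.
Unshelve. all: by end_near. Qed.

Lemma gradx_bilinear (w : bool * bool -> R) x :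
  gradx (fun y => \sum_c shape c y * w c) x =
  \sum_c ((if c.1 then 1 else - 1) * (if c.2 then x.2 else 1 - x.2)) * w c.
Proof.
apply: bilinear_directional_derivative => [h|]; last by rewrite /= mulr0.
rewrite !big_bool2 /shape /= /GRing.scale /= mulr1 mulr0; ring.
Qed.

Lemma grady_bilinear (w : bool * bool -> R) x :
  grady (fun y => \sum_c shape c y * w c) x =
  \sum_c ((if c.1 then x.1 else 1 - x.1) * (if c.2 then 1 else - 1)) * w c.
Proof.
apply: bilinear_directional_derivative => [h|]; last by rewrite /= mul0r.
rewrite !big_bool2 /shape /= /GRing.scale /= mulr1 mulr0; ring.
Qed.

End NodalBasis.

(** * Forms on broken functions as matrices in nodal coordinates *)

Section MeshForms.
Context {R : realType} {Om : set (R * R)} (M : mesh Om).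
Local Notation cell := 'I_(ncell M).
Local Notation rect := (rect (@lo R Om M) (@hi R Om M)).
Local Notation orect := (orect (@lo R Om M) (@hi R Om M)).
Local Notation dof := (cell * (bool * bool))%type.

Definition nodal (u : broken M) : dof -> R := fun q => u q.1 (node q.2).

Definition interp (w : dof -> R) : broken M :=
  fun i x => \sum_c shape c x * w (i, c).

Lemma nodalK (u : broken M) : piecewise_bilinear u -> interp (nodal u) = u.
Proof.
move=> pu; apply/funext => i; apply/funext => x.
by rewrite [RHS](bilinear_polyP _).1.
Qed.

Lemma interpK (w : dof -> R) : nodal (interp w) = w.
Proof.
apply/funext => -[i c]; rewrite /nodal /interp/= big_bool2 /shape /node.
by case: c => -[] [] /=; ring.
Qed.

Lemma piecewise_bilinearB (u v : broken M) :
  piecewise_bilinear u -> piecewise_bilinear v ->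
  piecewise_bilinear (bsub u v).
Proof.
move=> pu pv i; apply/bilinear_polyP => x; rewrite /bsub.
have -> := (bilinear_polyP (u i)).1 (pu i) x.
have -> := (bilinear_polyP (v i)).1 (pv i) x.
by rewrite -sumrB; apply: eq_bigr => c _; rewrite mulrBr.
Qed.

Local Notation cOm := (closure Om).

Lemma bounded_measurable_fst : bounded_measurable cOm (@fst R R).
Proof.
split; first exact: measurable_funTS measurable_fst.
by exists (mesh_bound M) => x /(closure_mesh_bounded M)[].
Qed.

Lemma bounded_measurable_snd : bounded_measurable cOm (@snd R R).
Proof.
split; first exact: measurable_funTS measurable_snd.
by exists (mesh_bound M) => x /(closure_mesh_bounded M)[].
Qed.

Lemma bounded_measurable_affine (f : R * R -> R) (b : bool) :
  bounded_measurable cOm f ->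
  bounded_measurable cOm (fun x => if b then f x else 1 - f x).
Proof.
case: b => // hf; have := bounded_measurableD (bounded_measurable_cst cOm 1)
  (bounded_measurableM (bounded_measurable_cst cOm (-1)) hf).
by congr bounded_measurable; apply/funext => x; rewrite mulN1r.
Qed.

Lemma pointwise_linear_interp (i : cell) :
  pointwise_linear cOm (fun w x => interp w i x).
Proof.
apply: pointwise_linear_sum => c.
apply: pointwise_linearM; last exact: pointwise_linear_coord.
by apply: bounded_measurableM; apply: bounded_measurable_affine;
  [exact: bounded_measurable_fst|exact: bounded_measurable_snd].
Qed.

Lemma pointwise_linear_gradx (i : cell) :
  pointwise_linear cOm (fun w x => gradx (interp w i) x).
Proof.
have -> : (fun w x => gradx (interp w i) x) = (fun w x =>
    \sum_c ((if c.1 then 1 else - 1) * (if c.2 then x.2 else 1 - x.2)) * w (i, c)).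
  apply/funext => w; apply/funext => x.
  exact: (gradx_bilinear (fun c => w (i, c))).
apply: pointwise_linear_sum => c.
apply: pointwise_linearM; last exact: pointwise_linear_coord.
apply: bounded_measurableM; first exact: bounded_measurable_cst.
by apply: bounded_measurable_affine; exact: bounded_measurable_snd.
Qed.

Lemma pointwise_linear_grady (i : cell) :
  pointwise_linear cOm (fun w x => grady (interp w i) x).
Proof.
have -> : (fun w x => grady (interp w i) x) = (fun w x =>
    \sum_c ((if c.1 then x.1 else 1 - x.1) * (if c.2 then 1 else - 1)) * w (i, c)).
  apply/funext => w; apply/funext => x.
  exact: (grady_bilinear (fun c => w (i, c))).
apply: pointwise_linear_sum => c.
apply: pointwise_linearM; last exact: pointwise_linear_coord.
apply: bounded_measurableM; last exact: bounded_measurable_cst.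
by apply: bounded_measurable_affine; exact: bounded_measurable_fst.
Qed.

(** Representability is asked only on interpolants, where the integrands are bounded and integration
    is additive. *)
Definition mesh_form (b : broken M -> broken M -> R) : Prop :=
  exists S, forall w1 w2, b (interp w1) (interp w2) = mxform S w1 w2.

Lemma mesh_formD b1 b2 : mesh_form b1 -> mesh_form b2 ->
  mesh_form (fun u v => b1 u v + b2 u v).
Proof.
move=> [S1 E1] [S2 E2]; exists (fun q r => S1 q r + S2 q r) => u v.
rewrite E1 E2 /mxform -big_split; apply: eq_bigr => q _; rewrite -big_split.
by apply: eq_bigr => r _; rewrite /= !mulrDl.
Qed.

Lemma mesh_formZ (c : R) b : mesh_form b -> mesh_form (fun u v => c * b u v).
Proof.
move=> [S E]; exists (fun q r => c * S q r) => u v.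
rewrite E /mxform mulr_sumr; apply: eq_bigr => q _; rewrite mulr_sumr.
by apply: eq_bigr => r _; rewrite !mulrA.
Qed.

Lemma mesh_form_sum (I : Type) (r : seq I) (P : pred I) b :
  (forall i, mesh_form (b i)) ->
  mesh_form (fun u v => \sum_(i <- r | P i) b i u v).
Proof.
move=> hb; elim: r => [|i r ih].
  exists (fun _ _ => 0) => u v; rewrite big_nil /mxform big1// => q _.
  by rewrite big1// => s _; rewrite !mul0r.
have [Pi|Pi] := boolP (P i).
  have := mesh_formD (hb i) ih; congr mesh_form.
  by apply/funext => u; apply/funext => v; rewrite big_cons Pi.
move: ih; congr mesh_form.
by apply/funext => u; apply/funext => v; rewrite big_cons (negPf Pi).
Qed.

Lemma mesh_form_int2 (i : cell) (K : broken M -> broken M -> R * R -> R) :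
  pointwise_bilinear cOm (fun w1 w2 => K (interp w1) (interp w2)) ->
  mesh_form (fun u v => int2 (orect i) (K u v)).
Proof.
move=> hK.
have mO := measurable_orect i.
have sub : orect i `<=` cOm.
  by apply: subset_trans (@subset_closure _ Om); exact: orect_sub_domain.
have fO : ((lebesgue_measure \x lebesgue_measure)%E (orect i) < +oo)%E.
  apply: le_lt_trans (closure_mesh_finite M); apply: le_measure; rewrite ?inE//.
  exact: measurable_closure_mesh.
have hK' : pointwise_bilinear (orect i) (fun w1 w2 => K (interp w1) (interp w2)).
  apply: (@pointwise_bilinear_comp _ _ _ _ _ _ _ cOm id _ _ _ _ hK).
  - exact: measurable_closure_mesh.
  - exact: measurable_id.
  - by move=> _ [x xi <-]; exact: sub.
(* [lebesgue_measure] lives on [measurableTypeR R], which has the same measurable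
   sets as [R] but another display, so inference must be overridden. *)
exact: (@Rintegral_pointwise_bilinear _ _ _
  (measurableTypeR R * measurableTypeR R)%type _ (lebesgue_measure \x lebesgue_measure)%E _ mO fO hK').
Qed.

Lemma side_sub_closure (i : cell) (s : side_type) (r : R) :
  side_range (@lo R Om M) (@hi R Om M) i s r ->
  cOm (side_point (@lo R Om M) (@hi R Om M) i s r).
Proof.
move=> hr; apply: (rect_sub_closure (i := i)); move: hr.
have [lh1 lh2] := mesh_nondeg i.
case: s => -[] [] /=; rewrite /side_range /side_point /= in_itv/= => hr.
all: by split=> //=; rewrite ?lexx ?(ltW lh1) ?(ltW lh2).
Qed.

Lemma mesh_form_side_int (i : cell) (s : side_type)
    (K : broken M -> broken M -> R * R -> R) :
  pointwise_bilinear cOm (fun w1 w2 => K (interp w1) (interp w2)) ->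
  mesh_form (fun u v => side_int (@lo R Om M) (@hi R Om M) i s (K u v)).
Proof.
move=> hK.
set D := side_range (@lo R Om M) (@hi R Om M) i s.
have mD : measurable D by exact: measurable_itv.
have fD : (lebesgue_measure D < +oo)%E.
  by rewrite /D /side_range; case: ifP => _; exact: lebesgue_itv_finite.
have hK' : pointwise_bilinear D (fun w1 w2 r =>
    K (interp w1) (interp w2) (side_point (@lo R Om M) (@hi R Om M) i s r)).
  apply: (@pointwise_bilinear_comp _ _ _ _ _ _ _ cOm _ _ _ _ _ hK).
  - exact: measurable_closure_mesh.
  - apply: measurable_funTS; case: (s) => -[] o; rewrite /side_point /=.
      by apply: measurable_fun_pair; [exact: measurable_id|exact: measurable_cst].
    by apply: measurable_fun_pair; [exact: measurable_cst|exact: measurable_id].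
  - by move=> _ [r Dr <-]; exact: side_sub_closure.
exact: (@Rintegral_pointwise_bilinear _ _ _ (measurableTypeR R)
  _ lebesgue_measure _ mD fD hK').
Qed.

Lemma pointwise_linear_glued : pointwise_linear cOm (fun w => glued (interp w)).
Proof.
apply: pointwise_linear_sum => i; apply: pointwise_linearM.
  by apply: bounded_measurable_indic; exact: measurable_orect.
exact: pointwise_linear_interp.
Qed.

Lemma glued0 (u : broken M) x : ~ Om x -> glued u x = 0.
Proof.
move=> Ox; rewrite /glued big1// => i _; rewrite indicE.
by rewrite memNset ?mul0r// => /orect_sub_domain.
Qed.

(** Glued functions vanish outside [Om], so the integral extends to the closure, the domain on which
    the integrands are controlled. *)
Lemma L2ip_closure (u v : broken M) :
  L2ip Om (glued u) (glued v) = int2 cOm (fun x => glued u x * glued v x).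
Proof.
rewrite /L2ip /int2 Rintegral_mkcond [RHS]Rintegral_mkcond.
apply: eq_Rintegral => x _; rewrite !patchE.
case: ifPn => [|/negP Ox]; first by rewrite inE => /subset_closure/mem_set ->.
by rewrite inE in Ox; rewrite glued0// mul0r if_same.
Qed.

Lemma mesh_form_L2ip : mesh_form (fun u v => L2ip Om (glued u) (glued v)).
Proof.
have [S SE] := @Rintegral_pointwise_bilinear _ _ _
  (measurableTypeR R * measurableTypeR R)%type
  _ (lebesgue_measure \x lebesgue_measure)%E _ (measurable_closure_mesh M)
  (closure_mesh_finite M)
  (pointwise_bilinear_prod pointwise_linear_glued pointwise_linear_glued).
by exists S => u v; rewrite L2ip_closure -SE.
Qed.

Lemma L2ip_ge0 (u : broken M) : 0 <= L2ip Om (glued u) (glued u).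
Proof. by apply: Rintegral_ge0 => x _; rewrite -expr2 sqr_ge0. Qed.

Lemma L2ip_sym (g1 g2 : R * R -> R) : L2ip Om g1 g2 = L2ip Om g2 g1.
Proof. by apply: eq_Rintegral => x _; rewrite mulrC. Qed.

(** * The discontinuous Galerkin form *)

Section DG.
Variables (a : R * R -> R) (a0 a1 gamma : R).
Hypothesis ha : coefficient Om a a0 a1.

Lemma bounded_measurable_coefficient : bounded_measurable cOm a.
Proof.
case: ha => a00 a10 ma aB; split => //; exists a1 => x /aB/andP[xa0 xa1].
by rewrite ger0_norm// (le_trans (ltW a00)).
Qed.

Let ba := bounded_measurable_coefficient.

Lemma mesh_form_stiff : mesh_form (stiff a).
Proof.
apply: mesh_form_sum => K; apply: mesh_form_sum => i.
apply: (@mesh_form_int2 i (fun u v x => a x * grad_dot (u i) (v i) x)).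
have := pointwise_bilinearD
  (pointwise_bilinear_prod (pointwise_linearM ba (pointwise_linear_gradx i))
    (pointwise_linear_gradx i))
  (pointwise_bilinear_prod (pointwise_linearM ba (pointwise_linear_grady i))
    (pointwise_linear_grady i)).
congr (pointwise_bilinear cOm _).
apply/funext => u; apply/funext => v; apply/funext => x.
by rewrite /grad_dot mulrDr !mulrA.
Qed.

Lemma pointwise_linear_normal_flux (i : cell) (s : side_type) :
  pointwise_linear cOm (fun w => normal_flux a (interp w) i s).
Proof.
apply: pointwise_linearM => //; apply: pointwise_linearM.
  exact: bounded_measurable_cst.
by case: s => -[] o; [exact: pointwise_linear_grady|exact: pointwise_linear_gradx].
Qed.

Lemma pointwise_linear_avg_flux (i : cell) (s : side_type) (oj : option cell) :
  pointwise_linear cOm (fun w => avg_flux a (interp w) i s oj).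
Proof.
case: oj => [j|] /=; last exact: pointwise_linear_normal_flux.
have := pointwise_linearM (bounded_measurable_cst cOm 2^-1)
  (pointwise_linearD (pointwise_linear_normal_flux i s)
    (pointwise_linear_normal_flux j s)).
congr (pointwise_linear cOm _).
by apply/funext => u; apply/funext => x; rewrite mulrC.
Qed.

Lemma pointwise_linear_jump (i : cell) (oj : option cell) :
  pointwise_linear cOm (fun w => jump (interp w) i oj).
Proof.
case: oj => [j|]; last exact: pointwise_linear_interp.
by apply: pointwise_linearB; exact: pointwise_linear_interp.
Qed.

Lemma mesh_form_skeleton_sum
    (K : broken M -> broken M -> cell -> side_type -> option cell -> R * R -> R) :
  (forall i s oj, pointwise_bilinear cOm
    (fun w1 w2 => K (interp w1) (interp w2) i s oj)) ->
  mesh_form (fun u v => skeleton_sum (K u v)).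
Proof.
move=> hK; do 3 (apply: mesh_form_sum => ?).
exact: (@mesh_form_side_int _ _ (fun u v => K u v _ _ _)).
Qed.

Lemma mesh_form_aDG : mesh_form (aDG a gamma).
Proof.
have f1 : mesh_form (fun u v => skeleton_sum (fun i s oj x =>
    avg_flux a u i s oj x * jump v i oj x)).
  apply: mesh_form_skeleton_sum => i s oj.
  exact: (pointwise_bilinear_prod (pointwise_linear_avg_flux i s oj)
    (pointwise_linear_jump i oj)).
have f2 : mesh_form (fun u v => skeleton_sum (fun i s oj x =>
    avg_flux a v i s oj x * jump u i oj x)).
  apply: mesh_form_skeleton_sum => i s oj.
  have := pointwise_bilinear_prod (pointwise_linear_jump i oj)
    (pointwise_linear_avg_flux i s oj).
  congr (pointwise_bilinear cOm _).
  by apply/funext => u; apply/funext => v; apply/funext => x; rewrite mulrC.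
have f3 : mesh_form (fun u v => skeleton_sum (fun (i : cell) (s : side_type) oj x =>
    a x * jump u i oj x * jump v i oj x)).
  apply: mesh_form_skeleton_sum => i s oj.
  exact: (pointwise_bilinear_prod (pointwise_linearM ba (pointwise_linear_jump i oj))
    (pointwise_linear_jump i oj)).
have := mesh_formD mesh_form_stiff (mesh_formD (mesh_formD (mesh_formZ (-1) f1)
  (mesh_formZ (-1) f2)) (mesh_formZ (gamma / fine_size M) f3)).
congr mesh_form; apply/funext => u; apply/funext => v.
by rewrite !mulN1r.
Qed.

(** Exchanging the arguments swaps the two flux terms; the stiffness and penalty terms are symmetric
    by themselves. *)
Lemma aDG_sym (u v : broken M) : aDG a gamma u v = aDG a gamma v u.
Proof.
have stiff_sym : stiff a u v = stiff a v u.
  apply: eq_bigr => K _; apply: eq_bigr => i _; congr (int2 _ _).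
  by apply/funext => x; rewrite /grad_dot (mulrC (gradx (u i) x))
    (mulrC (grady (u i) x)).
have penalty_sym :
    skeleton_sum (fun (i : cell) (s : side_type) oj x =>
      a x * jump u i oj x * jump v i oj x) =
    skeleton_sum (fun (i : cell) (s : side_type) oj x =>
      a x * jump v i oj x * jump u i oj x).
  congr skeleton_sum; apply/funext => i; apply/funext => s; apply/funext => oj.
  by apply/funext => x; rewrite mulrAC.
by rewrite /aDG stiff_sym penalty_sym (addrC (- skeleton_sum _)).
Qed.

End DG.
End MeshForms.

(** * Projection onto the multiscale space *)

Lemma sum_enum_rank (V : nmodType) (X : finType) (F : 'I_#|X| -> V) :
  \sum_(q : X) F (enum_rank q) = \sum_i F i.
Proof.
rewrite (reindex (@enum_val X X)) /=; last first.
  by exists enum_rank => i _; [exact: enum_valK|exact: enum_rankK].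
by apply: eq_bigr => i _; rewrite enum_valK.
Qed.

(** With the family as rows of [W] and $W^+$ a pseudo-inverse, $W^+W$ maps into the row space and
    fixes it, even when the rows are dependent. *)
Lemma span_projection (R : realType) (X J : finType) (g : J -> X -> R) :
  exists P : X -> X -> R,
    (forall w, exists c : J -> R, forall q, mxapp P w q = \sum_j c j * g j q) /\
    forall w (c : J -> R), (forall q, w q = \sum_j c j * g j q) -> mxapp P w = w.
Proof.
pose W : 'M[R]_(#|J|, #|X|) := \matrix_(j, q) g (enum_val j) (enum_val q).
pose vec (w : X -> R) : 'rV[R]_#|X| := \row_q w (enum_val q).
pose Q := pinvmx W *m W.
(* Transposed, because [Q] acts on row vectors from the right. *)
exists (fun q r => Q (enum_rank r) (enum_rank q)).
have PE w q : mxapp (fun q r => Q (enum_rank r) (enum_rank q)) w q =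
    (vec w *m Q) 0 (enum_rank q).
  rewrite mxE -sum_enum_rank; apply: eq_bigr => r _.
  by rewrite [vec w 0 _]mxE enum_rankK mulrC.
split=> [w|w c wE].
  exists (fun j => (vec w *m pinvmx W) 0 (enum_rank j)) => q.
  rewrite PE mulmxA mxE -sum_enum_rank; apply: eq_bigr => j _.
  by rewrite [W _ _]mxE !enum_rankK.
apply/funext => q; rewrite PE mulmxA mulmxKpV.
  by rewrite [vec w 0 _]mxE enum_rankK.
apply/submxP; exists (\row_j c (enum_val j)); apply/rowP => x.
rewrite !mxE wE -sum_enum_rank; apply: eq_bigr => j _.
by rewrite !mxE enum_rankK.
Qed.

Section MultiscaleSpace.
Context {R : realType} {Om : set (R * R)} {M : mesh Om} {a : R * R -> R}.
Variables (B : local_bases M a) (p m : 'I_(nblock M) -> nat).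
Local Notation cell := 'I_(ncell M).
Local Notation block := 'I_(nblock M).
Local Notation dof := (cell * (bool * bool))%type.

Definition basis_index : Type := {K : block & ('I_(nbnodes K) + 'I_(nint B K))%type}.
HB.instance Definition _ := Finite.on basis_index.

(** Unselected eigenfunctions are replaced by zero, so that one index type serves every choice of
    [p] and [m]. *)
Definition local_basis (K : block) (j : 'I_(nbnodes K) + 'I_(nint B K)) : broken M :=
  match j with
  | inl j => if (j < p K)%N then @wt _ _ _ _ B K j else fun _ _ => 0
  | inr j => if (j < m K)%N then @z _ _ _ _ B K j else fun _ _ => 0
  end.

Lemma local_basis_bilinear K j : piecewise_bilinear (@local_basis K j).
Proof.
have b0 : piecewise_bilinear (fun (_ : cell) (_ : R * R) => 0 : R).
  by move=> i; exists 0, 0, 0, 0 => x; rewrite !mul0r !addr0.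
case: j => j /=; case: ifP => // _.
- by have [/(_ j)[[]]] := wt_eigen B K.
- by have [/(_ j)[[]]] := z_eigen B K.
Qed.

(** Exhibits the multiscale space as the span of one finite global family, each local function being
    cut off outside its block. *)
Lemma VHE (u : broken M) : VH B p m u <->
  exists c : basis_index -> R, forall i x,
    u i x = \sum_(k : basis_index) c k *
      (if blk i == tag k then local_basis (tagged k) i x else 0).
Proof.
(* Only the block containing cell [i] contributes. *)
have sumE (c : basis_index -> R) i x :
    \sum_(k : basis_index) c k *
      (if blk i == tag k then local_basis (tagged k) i x else 0) =
    \sum_(j < nbnodes (blk i) | (j < p (blk i))%N)
       c (Tagged _ (inl j)) * @wt _ _ _ _ B (blk i) j i x +
    \sum_(j < nint B (blk i) | (j < m (blk i))%N)
       c (Tagged _ (inr j)) * @z _ _ _ _ B (blk i) j i x.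
  transitivity (\sum_(K : block) \sum_(j : 'I_(nbnodes K) + 'I_(nint B K))
     c (Tagged _ j) * (if blk i == K then local_basis j i x else 0)).
    rewrite (sig_big_dep _ _ (fun K (j : 'I_(nbnodes K) + 'I_(nint B K)) =>
      c (Tagged _ j) * (if blk i == K then local_basis j i x else 0))) /=.
    by apply: eq_bigr => -[].
  rewrite (bigD1 (blk i))//= [X in _ + X]big1 ?addr0; last first.
    move=> K /negPf; rewrite eq_sym => ->; apply: big1 => j _.
    by rewrite mulr0.
  rewrite eqxx big_sumType /=; congr (_ + _); rewrite [RHS]big_mkcond;
    by apply: eq_bigr => j _; case: ifP; rewrite ?mulr0.
split=> [hu|[c uE] K].
(* Coefficients exist for each block separately; choice collects them into one global family. *)
- pose c K := projT1 (cid (hu K)).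
  pose d K := projT1 (cid (projT2 (cid (hu K)))).
  exists (fun k => match tagged k with inl j => c (tag k) j | inr j => d (tag k) j end).
  move=> i x; rewrite sumE /=.
  exact: (projT2 (cid (projT2 (cid (hu (blk i))))) i x erefl).
- exists (fun j => c (Tagged _ (inl j))), (fun j => c (Tagged _ (inr j))).
  by move=> i x iK; rewrite uE sumE; case: _ / iK.
Qed.

Lemma VH_bilinear (u : broken M) : VH B p m u -> piecewise_bilinear u.
Proof.
move=> /VHE[c uE] i; apply/bilinear_polyP => x; rewrite uE.
under [RHS]eq_bigr do rewrite uE mulr_sumr.
rewrite exchange_big; apply: eq_bigr => -[K j] _ /=.
case: ifP => _; last by rewrite mulr0 big1// => ? _; rewrite !mulr0.
rewrite [in LHS](bilinear_polyP _).1; last exact: local_basis_bilinear.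
by rewrite mulr_sumr; apply: eq_bigr => e _; rewrite mulrCA.
Qed.

(** The family is projected onto at the level of nodal values; this lifts to functions because each
    basis function is the interpolant of its nodal values. *)
Lemma VH_projection : exists P : dof -> dof -> R,
  (forall w, VH B p m (interp (mxapp P w))) /\
  forall w, VH B p m (interp w) -> mxapp P w = w.
Proof.
pose g (k : basis_index) (q : dof) : R :=
  if blk q.1 == tag k then local_basis (tagged k) q.1 (node q.2) else 0.
have [P [P1 P2]] := span_projection g.
exists P; split=> w.
  have [c Pw] := P1 w; apply/VHE; exists c => i x; rewrite /interp.
  under eq_bigr do rewrite Pw mulr_sumr.
  rewrite exchange_big; apply: eq_bigr => -[K j] _; rewrite /g /=.
  case: ifP => _; last by rewrite mulr0 big1// => ? _; rewrite !mulr0.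
  rewrite [in RHS](bilinear_polyP _).1; last exact: local_basis_bilinear.
  by rewrite mulr_sumr; apply: eq_bigr => e _; rewrite mulrCA.
move=> /VHE[c wE]; apply: (P2 _ c) => -[i e].
by rewrite -[in LHS](interpK w) /nodal wE.
Qed.

End MultiscaleSpace.

(** * Time derivatives *)

Section TimeDerivative.
Context {R : realType} {Om : set (R * R)} {M : mesh Om}.
Variable T : R.
Hypothesis T_gt0 : 0 < T.
Implicit Types U V : R -> broken M.

(** The interpolation identity passes to the limit of the difference quotients. The matrices can
    thus be applied to time derivatives as well. *)
Lemma time_derivative_bilinear U V : time_derivative T U V ->
  (forall t, 0 <= t <= T -> piecewise_bilinear (U t)) ->
  forall t, 0 <= t <= T -> piecewise_bilinear (V t).
Proof.
move=> dU pU t tT i; apply/bilinear_polyP => x.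
have FF := within_dnbhs_itv_proper T_gt0 tT.
rewrite -(cvg_lim (@Rhausdorff R) (dU t tT i x)).
apply: cvg_lim; first exact: Rhausdorff.
have cS : (fun s => \sum_c shape c x * ((U s i (node c) - U t i (node c)) / (s - t))) @
    within [set s : R | 0 <= s <= T] t^' --> \sum_c shape c x * V t i (node c).
  rewrite big_bool2; under eq_fun do rewrite big_bool2.
  by do ![apply: cvgD]; apply: cvgM; try exact: cvg_cst; exact: dU.
apply: cvg_trans cS; apply: near_eq_cvg.
(* The filter only sees times in [[0, T]], where [U s] is known to be bilinear. *)
rewrite near_withinE; apply: nearW => s /= sT.
rewrite (bilinear_polyP (U s i)).1; last exact: pU.
rewrite [U t i x](bilinear_polyP (U t i)).1; last exact: pU.
rewrite -sumrB mulr_suml; apply: eq_bigr => c _.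
by rewrite mulrA mulrBr.
Qed.

Lemma derivative_on_nodal U V : time_derivative T U V ->
  forall q, derivative_on T (fun t => nodal (U t) q) (fun t => nodal (V t) q).
Proof. by move=> dU q; apply: derivative_on_quotient => // t tT; exact: dU. Qed.

End TimeDerivative.

(** * The error estimate *)

Theorem theorem2 (R : realType) (Om : set (R * R)) (a : R * R -> R)
    (a0 a1 T : R) (hOm : bounded_domain Om) (ha : coefficient Om a a0 a1)
    (hT : 0 < T) :
  exists2 C : R, 0 < C &
  forall (M : mesh Om) (B : local_bases M a) (p m : 'I_(nblock M) -> nat)
    (hp : forall K : 'I_(nblock M), (p K <= nbnodes K)%N) (hm : forall K : 'I_(nblock M), (m K <= nint B K)%N)
    (gamma : R) (hgamma : penalty_large a (VH B p m) gamma)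
    (f : R -> R * R -> R) (hf : forall t : R, 0 <= t <= T -> L2fun Om (f t))
    (g0 g1 : R * R -> R) (hg0 : L2fun Om g0) (hg1 : L2fun Om g1)
    (uh uh_t uh_tt uH uH_t uH_tt wH wH_t wH_tt : R -> broken M)
    (uh_der : time_derivative T uh uh_t /\ time_derivative T uh_t uh_tt)
    (uH_der : time_derivative T uH uH_t /\ time_derivative T uH_t uH_tt)
    (wH_der : time_derivative T wH wH_t /\ time_derivative T wH_t wH_tt)
    (uh_Vh : forall t : R, 0 <= t <= T -> Vh M (uh t))
    (uh_eq : forall (t : R) (v : broken M), 0 <= t <= T -> Vh M v ->
      L2ip Om (glued (uh_tt t)) (glued v) + stiff a (uh t) v
      = L2ip Om (f t) (glued v))
    (uh_init : same_L2proj (VH B p m) (glued (uh 0)) g0 /\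
               same_L2proj (VH B p m) (glued (uh_t 0)) g1)
    (uH_VH : forall t : R, 0 <= t <= T -> VH B p m (uH t))
    (uH_eq : forall (t : R) (v : broken M), 0 <= t <= T -> VH B p m v ->
      L2ip Om (glued (uH_tt t)) (glued v) + aDG a gamma (uH t) v
      = L2ip Om (f t) (glued v))
    (uH_init : L2proj (VH B p m) g0 (uH 0) /\ L2proj (VH B p m) g1 (uH_t 0))
    (wH_VH : forall t : R, 0 <= t <= T -> VH B p m (wH t))
    (wH_eq : forall (t : R) (v : broken M), 0 <= t <= T -> VH B p m v ->
      aDG a gamma (wH t) v
      = aDG a gamma (uh t) v
        + consistency_error a gamma (f t) (uh t) (uh_tt t) v),
  let eta := fun t : R => bsub (uh t) (wH t) in
  let eta_t := fun t : R => bsub (uh_t t) (wH_t t) in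
  let xi := fun t : R => bsub (uH t) (wH t) in
  let eps := fun t : R => bsub (uh t) (uH t) in
  Linf_L2 T eps <= C * (L1_L2 T eta_t + Linf_L2 T eta + L2norm (xi 0)).
Proof.
(* The 2 is the factor of the time integral in the energy estimate; the other two terms arise with
   factor 1. It is fixed before the mesh is introduced. *)
exists 2 => // M B p m hp hm gamma hgamma f hf g0 g1 hg0 hg1.
move=> uh uh_t uh_tt uH uH_t uH_tt wH wH_t wH_tt [duh duh1] [duH duH1] [dwH dwH1].
move=> uh_Vh _ [_ uh_init] uH_VH uH_eq [_ uH_init] wH_VH wH_eq.
pose eta t := bsub (uh t) (wH t); pose eta_t t := bsub (uh_t t) (wH_t t).
pose xi t := bsub (uH t) (wH t); pose eps t := bsub (uh t) (uH t).
change (Linf_L2 T eps <= 2 * (L1_L2 T eta_t + Linf_L2 T eta + L2norm (xi 0))).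
have puh t : 0 <= t <= T -> piecewise_bilinear (uh t) by move=> /uh_Vh[].
have puH t : 0 <= t <= T -> piecewise_bilinear (uH t).
  by move=> /uH_VH/VH_bilinear.
have pwH t : 0 <= t <= T -> piecewise_bilinear (wH t).
  by move=> /wH_VH/VH_bilinear.
have puh1 := time_derivative_bilinear hT duh puh.
have puh2 := time_derivative_bilinear hT duh1 puh1.
have puH1 := time_derivative_bilinear hT duH puH.
have puH2 := time_derivative_bilinear hT duH1 puH1.
have pwH1 := time_derivative_bilinear hT dwH pwH.
have [S SE] := mesh_form_L2ip M.
have [A AE] := mesh_form_aDG M gamma ha.
have [P [VP PV]] := VH_projection B p m.
have Ssym u v : mxform S u v = mxform S v u by rewrite -!SE L2ip_sym.
have Spsd u : 0 <= mxform S u u by rewrite -SE; exact: L2ip_ge0.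
have Asym u v : mxform A u v = mxform A v u by rewrite -!AE aDG_sym.
have SEl u v : piecewise_bilinear u ->
    mxform S (nodal u) v = L2ip Om (glued u) (glued (interp v)).
  by move=> pu; rewrite -SE nodalK.
have AEl u v : piecewise_bilinear u ->
    mxform A (nodal u) v = aDG a gamma u (interp v).
  by move=> pu; rewrite -AE nodalK.
have normE u : piecewise_bilinear u -> L2norm u = mxnorm S (nodal u).
  by move=> pu; rewrite /L2norm /mxnorm SEl// nodalK.
have T0 : 0 <= (0 : R) <= T by rewrite lexx ltW.
pose V : set ('I_(ncell M) * (bool * bool) -> R) := [set w | VH B p m (interp w)].
have VV u : VH B p m u -> V (nodal u).
  by move=> hu; rewrite /V /= nodalK//; exact: VH_bilinear hu.
(* By coercivity, half the squared energy norm is a lower bound. *)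
have Apsd v : V v -> 0 <= mxform A v v.
  move=> Vv; have [_ /(_ _ _ Vv Vv)[h _]] := hgamma.
  by rewrite -AE (le_trans _ h)// divr_ge0// sqr_ge0.
(* Both sides equal $(f,v)$: by the consistency error, $a_{DG}(w_H,v)=(f,v)-(\partial_t^2u_h,v)$. *)
have eqn t v : 0 <= t <= T -> V v ->
    mxform S (nodal (uH_tt t)) v + mxform A (nodal (uH t)) v =
    mxform S (nodal (uh_tt t)) v + mxform A (nodal (wH t)) v.
  move=> tT Vv; rewrite !SEl ?AEl; auto.
  by rewrite (uH_eq t _ tT Vv) (wH_eq t _ tT Vv) /consistency_error; ring.
(* Both initial velocities have the same products with [V] as [g1]. *)
have init v : V v -> mxform S (nodal (uH_t 0)) v = mxform S (nodal (uh_t 0)) v.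
  move=> Vv; have [q [[_ q1] [_ q2]]] := uh_init; have [_ q3] := uH_init.
  by rewrite !SEl; auto; rewrite q3// -q2// q1.
have xi_le := wave_energy_estimate (V := V) hT Ssym Spsd Asym Apsd VP PV
  (derivative_on_nodal duh1) (derivative_on_nodal duH)
  (derivative_on_nodal duH1) (derivative_on_nodal dwH)
  (fun q => (derivative_on_nodal dwH1 q).1)
  (fun t tT => VV _ (uH_VH t tT)) (fun t tT => VV _ (wH_VH t tT)) eqn init.
have nodalB u v : nodal (bsub u v) = fun q => nodal u q - nodal v q by [].
have L1E : L1_L2 T eta_t = \int[lebesgue_measure]_(t in `[0, T])
    mxnorm S (fun q => nodal (uh_t t) q - nodal (wH_t t) q).
  apply: eq_Rintegral => t; rewrite inE/= in_itv/= => tT.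
  by rewrite normE//; apply: piecewise_bilinearB; auto.
have xi0E : L2norm (xi 0) = mxnorm S (fun q => nodal (uH 0) q - nodal (wH 0) q).
  by rewrite normE//; apply: piecewise_bilinearB; auto.
have etaE t : 0 <= t <= T ->
    L2norm (eta t) = mxnorm S (fun q => nodal (uh t) q - nodal (wH t) q).
  by move=> tT; rewrite normE//; apply: piecewise_bilinearB; auto.
(* On an unbounded set [sup] would be a default value, so a bound is first obtained from the extreme
   value theorem. *)
have eta_le t : 0 <= t <= T -> L2norm (eta t) <= Linf_L2 T eta.
  move=> tT; apply: ub_le_sup; last by exists t; rewrite //= in_itv.
  have ceta q : {within `[0, T], continuous fun t =>
      nodal (uh t) q - nodal (wH t) q}.
    exact: (derivative_onB (derivative_on_nodal duh q)
      (derivative_on_nodal dwH q)).1.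
  have [tau _ Mtau] := EVT_max (ltW hT) (within_continuous_mxnorm (S := S) ceta).
  exists (mxnorm S (fun q => nodal (uh tau) q - nodal (wH tau) q)).
  move=> _ [s /= sT <-]; rewrite etaE; last by rewrite in_itv in sT.
  exact: Mtau.
have eta0 : 0 <= Linf_L2 T eta by apply: le_trans (eta_le 0 T0); exact: sqrtr_ge0.
have L10 : 0 <= L1_L2 T eta_t by apply: Rintegral_ge0 => t _; exact: sqrtr_ge0.
have xi00 : 0 <= L2norm (xi 0) by exact: sqrtr_ge0.
apply: ge_sup.
  by exists (L2norm (eps 0)); exists 0 => //=; rewrite in_itv.
move=> _ [t /= + <-]; rewrite in_itv/= => tT.
(* The splitting $\varepsilon=\eta-\xi$ in nodal coordinates. *)
have epsE : L2norm (eps t) = mxnorm S (fun q =>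
    (nodal (uh t) q - nodal (wH t) q) - (nodal (uH t) q - nodal (wH t) q)).
  rewrite normE; last by apply: piecewise_bilinearB; auto.
  by rewrite nodalB; congr mxnorm; apply/funext => q; ring.
rewrite epsE (le_trans (mxnormB Ssym Spsd _ _))// -etaE//.
have := eta_le t tT; have := xi_le t tT; rewrite -L1E -xi0E => *; lra.
Qed.
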